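(* There exist absolute constants $\varepsilon_0>0$ and $C_{\mathrm{lin}}<\infty$ such that, for all sufficiently large $n$ and all $1\le k\le\varepsilon_0 n$, the half-lazy kernel $Q_{n,k}=\frac12(I+P_{n,k})$ satisfies $\tau_{\mathrm{mix}}(Q_{n,k})\le C_{\mathrm{lin}}\,nk\log n$.
   Context: Let $V=\mathbb F_2^k$ and $\mathrm{St}(n,k)=\{(z_1,\dots,z_n)\in V^n:\operatorname{span}(z_1,\dots,z_n)=V\}$. The kernel $P_{n,k}$ on $\mathrm{St}(n,k)$: choose an ordered pair $(a,b)$ of distinct indices in $\{1,\dots,n\}$ uniformly at random and replace $z_b$ by $z_b+z_a$. Its stationary law $\pi$ is uniform on $\mathrm{St}(n,k)$. $\tau_{\mathrm{mix}}(Q)=\min\{t\ge0:\max_x\|Q^t(x,\cdot)-\pi\|_{\mathrm{TV}}\le1/4\}$. *)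

(* Defs.v *)
From HB Require Import structures.
From mathcomp Require Import all_boot all_order all_algebra.
From mathcomp Require Import Rstruct.
From Stdlib Require Import Rdefinitions Rfunctions.
From Stdlib Require Rpower.

Set Implicit Arguments. Unset Strict Implicit. Unset Printing Implicit Defensive.
Import Order.TTheory GRing.Theory Num.Theory.
Local Open Scope ring_scope.

Definition config (n k : nat) := {ffun 'I_n -> 'rV['F_2]_k}.

Definition spans (n k : nat) (z : config n k) : bool :=
  row_full (\matrix_(i < n) z i).

Definition St (n k : nat) : {set config n k} := [set z | spans z].

Definition move (n k : nat) (z : config n k) (a b : 'I_n) : config n k :=
  [ffun i => if i == b then z b + z a else z i].

Definition Pker (n k : nat) (x y : config n k) : R :=
  (#|[set p : 'I_n * 'I_n | (p.1 != p.2) && (move x p.1 p.2 == y)]|)%:R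
  / (n * n.-1)%:R.

Definition Qker (n k : nat) (x y : config n k) : R :=
  ((x == y)%:R + Pker x y) / 2.

Fixpoint Qpow (n k : nat) (t : nat) (x y : config n k) : R :=
  match t with
  | 0 => (x == y)%:R
  | t'.+1 => \sum_(z : config n k) Qpow t' x z * Qker z y
  end.

Definition piU (n k : nat) (y : config n k) : R :=
  (y \in St n k)%:R / #|St n k|%:R.

Definition tv (n k : nat) (mu nu : config n k -> R) : R :=
  (\sum_(y : config n k) `|mu y - nu y|) / 2.

(* tau_mix(Q) <= X  iff  some t <= X has max_{x in St} ||Q^t(x,.) - pi||_TV <= 1/4 *)
Definition mixes_by (n k : nat) (t : nat) : Prop :=
  forall x : config n k, x \in St n k -> tv (Qpow t x) (@piU n k) <= 1 / 4.

(* Main.v *)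
(** Each move is an involution, so the chain is symmetric on all of [V^n] and acts on densities
    through the same averaging operator. Given the other coordinates, updating [z_b] is a lazy walk
    on [V]; if every nonzero functional [p] has at least [M], of order [n], indices [a <> b] with
    [p . z_a <> 0], the walk has a spectral gap of constant order by Fourier analysis on [V], hence
    contracts entropy by a factor [1 - c/k], as [ln #|V|] is of order [k]. Replace the update by a
    full resampling of [z_b] when this fails: by subadditivity of entropy on [V^n], the modified
    chain contracts entropy by [1 - c/(nk)] per step, and the initial entropy is at most [nk], so
    [O(nk log n)] steps suffice.

    The two chains are compared in total variation after a burn-in. For fixed [p <> 0] the number of
    [a] with [p . z_a <> 0] is a birth-death chain started at [w >= 1]; the Lyapunov function
    [r^w / w] shows that after [O(n (k + log n))] steps it is at most [M] with probability so small
    that the sum over all [p] and over [O(nk log n)] steps is negligible. Finally, the law is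
    supported on spanning configurations, so closeness to uniform on [V^n] gives closeness to
    uniform on [St n k]. *)
Require Import Defs.
From HB Require Import structures.
From mathcomp Require Import all_boot all_order all_algebra.
From mathcomp Require Import zify ring lra.
From mathcomp Require Import Rstruct.
From Stdlib Require Import Rdefinitions Rfunctions.
From Stdlib Require Rpower.
Import Order.TTheory GRing.Theory Num.Theory.
Local Open Scope ring_scope.
Set Implicit Arguments. Unset Strict Implicit. Unset Printing Implicit Defensive.

(* Stdlib parses arguments of type [R] in [R_scope] and takes over the keys [%N], [%R]. *)
Bind Scope ring_scope with R.
Delimit Scope nat_scope with N.
Delimit Scope ring_scope with R.
Local Arguments Rpower.ln x%_ring_scope.

Local Notation ln := Rpower.ln.

(** * Logarithm, entropy and Bernoulli-type inequalities on the reals *)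

Lemma lnM (x y : R) : 0 < x -> 0 < y -> ln (x * y) = ln x + ln y.
Proof. by move=> /RltP x0 /RltP y0; exact: Rpower.ln_mult. Qed.

Lemma ln_one : ln 1 = 0 :> R.
Proof. exact: Rpower.ln_1. Qed.

Lemma lnV (x : R) : 0 < x -> ln x^-1 = - ln x.
Proof.
move=> x0; apply/eqP; rewrite -addr_eq0 -lnM ?invr_gt0 //.
by rewrite mulVf ?lt0r_neq0 // ln_one.
Qed.

Lemma ln_div (x y : R) : 0 < x -> 0 < y -> ln (x / y) = ln x - ln y.
Proof. by move=> x0 y0; rewrite lnM ?invr_gt0 // lnV. Qed.

Lemma lnX (x : R) m : 0 < x -> ln (x ^+ m) = m%:R * ln x.
Proof.
move=> x0; elim: m => [|m IH]; first by rewrite expr0 ln_one mul0r.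
by rewrite exprS lnM ?exprn_gt0 // IH -natr1 mulrDl mul1r addrC.
Qed.

Lemma ln_le_sub1 (x : R) : 0 < x -> ln x <= x - 1.
Proof.
move=> /RltP x0; have := Rpower.exp_ineq1_le (ln x).
rewrite Rpower.exp_ln // => /RleP h; have {h} : 1 + ln x <= x by []; lra.
Qed.

Lemma ler_ln (x y : R) : 0 < x -> x <= y -> ln x <= ln y.
Proof.
move=> x0; rewrite le_eqVlt => /predU1P[-> //|xy]; apply/ltW/RltP.
by apply: Rpower.ln_increasing; apply/RltP.
Qed.

(** Multiply [ln (m / x) <= m / x - 1] by [x]. Summed over a space, this gives Jensen's inequality
    and the nonnegativity of relative entropy. *)
Lemma xlnx_ge_tangent (x m : R) : 0 < x -> 0 < m -> x - m <= x * ln x - x * ln m.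
Proof.
move=> x0 m0; have := ln_le_sub1 (divr_gt0 m0 x0).
rewrite lnM ?invr_gt0 // lnV // => /(ler_wpM2l (ltW x0)).
rewrite !mulrBr mulrCA divff ?lt0r_neq0 // !mulr1; lra.
Qed.

(* The logarithm is kept in sqrt form: [ln t = 2 ln (sqrt t) <= 2 (sqrt t - 1)]. *)
Lemma xlnx_ge_sqrt (x m : R) : 0 < x -> 0 < m ->
  2 * (x - Num.sqrt x * Num.sqrt m) <= x * ln x - x * ln m.
Proof.
move=> x0 m0; have sx0 : 0 < Num.sqrt x by rewrite sqrtr_gt0.
have sm0 : 0 < Num.sqrt m by rewrite sqrtr_gt0.
have hx : Num.sqrt x * Num.sqrt x = x by rewrite -expr2 sqr_sqrtr // ltW.
have hm : Num.sqrt m * Num.sqrt m = m by rewrite -expr2 sqr_sqrtr // ltW.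
have := xlnx_ge_tangent sx0 sm0.
have -> : ln x = 2 * ln (Num.sqrt x) by rewrite -{1}hx lnM //; lra.
have -> : ln m = 2 * ln (Num.sqrt m) by rewrite -{1}hm lnM //; lra.
move: sx0 sm0 hx hm; move: (Num.sqrt x) (Num.sqrt m) => s r s0 _ <- _.
by move=> /(ler_wpM2l (ltW s0)); lra.
Qed.

(** Convexity with a quantitative gain: [xlnx_ge_sqrt] is applied at both points with [m] the
    midpoint. The gain, summed over translations, is the Dirichlet form of the square root, to which
    a spectral gap applies. *)
Lemma xlnx_midpoint (x y : R) : 0 < x -> 0 < y ->
  ((x + y) / 2) * ln ((x + y) / 2) + (Num.sqrt x - Num.sqrt y) ^+ 2 / 4
  <= (x * ln x + y * ln y) / 2.
Proof.
move=> x0 y0; set m := (x + y) / 2; have m0 : 0 < m by rewrite /m; lra.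
have := xlnx_ge_sqrt x0 m0; have := xlnx_ge_sqrt y0 m0.
have sx2 : Num.sqrt x * Num.sqrt x = x by rewrite -expr2 sqr_sqrtr // ltW.
have sy2 : Num.sqrt y * Num.sqrt y = y by rewrite -expr2 sqr_sqrtr // ltW.
have sm2 : Num.sqrt m * Num.sqrt m = m by rewrite -expr2 sqr_sqrtr // ltW.
have sx0 : 0 < Num.sqrt x by rewrite sqrtr_gt0.
have sy0 : 0 < Num.sqrt y by rewrite sqrtr_gt0.
have sm0 : 0 < Num.sqrt m by rewrite sqrtr_gt0.
have em : 2 * m = x + y by rewrite /m; lra.
have {m0} -> : m * ln m = (x * ln m + y * ln m) / 2 by rewrite -mulrDl -em; lra.
set lm := ln m; set s := Num.sqrt x in sx2 sx0 *; set r := Num.sqrt y in sy2 sy0 *.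
set t := Num.sqrt m in sm2 sm0 *.
move=> h1 h2.
suff : (s - r) ^+ 2 / 2 <= 2 * (x - s * t) + 2 * (y - r * t) by rewrite expr2; lra.
have : 0 <= (2 * t - s - r) ^+ 2 by exact: sqr_ge0.
rewrite !expr2; nra.
Qed.

(** Bounds a relative entropy density by a squared Hellinger distance, at a logarithmic price. If
    [s <= 2 * r] the ratio is bounded and the factor 5 is enough; otherwise [x <= 4 * (s - r) ^+ 2],
    and the logarithm of the ratio is at most [ln K]. *)
Lemma xlnx_le_sqr (x y K : R) : 0 < x -> 0 < y -> 1 <= K -> x <= K * y ->
  x * ln x - x * ln y - x + y
  <= (5 + 4 * ln K) * (Num.sqrt x - Num.sqrt y) ^+ 2.
Proof.
move=> x0 y0 K1 xKy.
have K0 : 0 < K by lra.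
have lnK0 : 0 <= ln K by rewrite -ln_one ler_ln.
have hx : Num.sqrt x * Num.sqrt x = x by rewrite -expr2 sqr_sqrtr // ltW.
have hy : Num.sqrt y * Num.sqrt y = y by rewrite -expr2 sqr_sqrtr // ltW.
have s0 : 0 < Num.sqrt x by rewrite sqrtr_gt0.
have r0 : 0 < Num.sqrt y by rewrite sqrtr_gt0.
set s := Num.sqrt x in hx s0 *; set r := Num.sqrt y in hy r0 *.
have [sr|rs] := leP s (2 * r).
  have lnsr : ln x - ln y <= 2 * (s / r - 1).
    have := ln_le_sub1 (divr_gt0 s0 r0); rewrite lnM ?invr_gt0 // lnV //.
    by rewrite -hx -hy !lnM //; lra.
  have p1 : x * (ln x - ln y) <= x * (2 * (s / r - 1)) by rewrite ler_wpM2l // ltW.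
  have p2 : x * (2 * (s / r - 1)) - x + y = (s - r) ^+ 2 * (2 * (s / r) + 1).
    by rewrite -hx -hy; field; rewrite gt_eqF.
  have p3 : (s - r) ^+ 2 * (2 * (s / r) + 1) <= (s - r) ^+ 2 * 5.
    by rewrite ler_wpM2l ?sqr_ge0 //; (have : s / r <= 2 by rewrite ler_pdivrMr); lra.
  have p4 : 0 <= ln K * (s - r) ^+ 2 by rewrite mulr_ge0 ?sqr_ge0.
  lra.
have lnxy : ln x <= ln K + ln y by rewrite -lnM // ler_ln.
have p1 : x * ln x <= x * (ln K + ln y) by rewrite ler_wpM2l // ltW.
have p2 : x <= 4 * (s - r) ^+ 2 by rewrite -hx expr2; nra.
have p3 : ln K * x <= ln K * (4 * (s - r) ^+ 2) by rewrite ler_wpM2l.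
have p4 : y <= x by rewrite -hx -hy; nra.
have : 0 <= (s - r) ^+ 2 by exact: sqr_ge0.
lra.
Qed.

(** A linear form of Pinsker's inequality: factor [f - 1] as [(s - 1) * (s + 1)] and use the
    arithmetic-geometric mean inequality with weight [e]. Leaving [e] free lets the bound be summed
    pointwise. *)
Lemma abs_sub1_le (f e : R) : 0 < f -> 0 < e ->
  `|f - 1| <= (f * ln f - f + 1) / (2 * e) + e * (f + 1).
Proof.
move=> f0 e0; have := xlnx_ge_sqrt f0 ltr01.
rewrite ln_one sqrtr1 mulr1 mulr0 subr0 => h.
have hf : Num.sqrt f * Num.sqrt f = f by rewrite -expr2 sqr_sqrtr // ltW.
have s0 : 0 < Num.sqrt f by rewrite sqrtr_gt0.
set s := Num.sqrt f in hf s0 h *.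
have h2 : (s - 1) ^+ 2 <= f * ln f - f + 1 by rewrite expr2; lra.
apply: le_trans (_ : (s - 1) ^+ 2 / (2 * e) + e * (f + 1) <= _); last first.
  by rewrite lerD2r ler_wpM2r // invr_ge0; lra.
have -> : f - 1 = (s - 1) * (s + 1) by lra.
rewrite normrM (gtr0_norm (_ : 0 < s + 1)); last by lra.
set d := `|s - 1|.
have -> : (s - 1) ^+ 2 = d ^+ 2 by rewrite /d real_normK ?num_real.
have h3 : (s + 1) ^+ 2 <= 2 * (f + 1) by have := sqr_ge0 (s - 1); rewrite !expr2; lra.
have h4 : 0 <= (d / e - (s + 1)) ^+ 2 * e by rewrite mulr_ge0 ?sqr_ge0 // ltW.
have h5 : (d / e - (s + 1)) ^+ 2 * e = d ^+ 2 / e - 2 * (d * (s + 1)) + (s + 1) ^+ 2 * e.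
  by field; rewrite gt_eqF.
have h6 : (s + 1) ^+ 2 * e <= 2 * (f + 1) * e by rewrite ler_wpM2r // ltW.
have -> : d ^+ 2 / (2 * e) = d ^+ 2 / e / 2 by field; rewrite gt_eqF.
lra.
Qed.

(* Bernoulli's inequality applied to [m/(m-1) = 1 + 1/(m-1)]. *)
Lemma one_sub_inv_expn_le (m : nat) : (0 < m)%N -> (1 - m%:R^-1) ^+ m <= 2^-1 :> R.
Proof.
case: m => // -[|m] _; first by rewrite invr1 subrr expr1; lra.
have m0 : 0 < m.+1%:R :> R by rewrite ltr0n.
have bern (x : R) j : 0 <= x -> 1 + j%:R * x <= (1 + x) ^+ j.
  move=> x0; elim: j => [|j IH]; first by rewrite expr0 mul0r addr0.
  rewrite exprS; apply: le_trans (_ : (1 + x) * (1 + j%:R * x) <= _); last first.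
    by rewrite ler_wpM2l // addr_ge0.
  rewrite -natr1; have : 0 <= x * (j%:R * x) by rewrite !mulr_ge0.
  lra.
have -> : 1 - m.+2%:R^-1 = (1 + m.+1%:R^-1)^-1 :> R.
  by rewrite -(natr1 m.+1); field; rewrite !gt_eqF //=; lra.
rewrite exprVn lef_pV2 ?posrE //; last first.
  by rewrite exprn_gt0 // addr_gt0 ?invr_gt0.
apply: le_trans (bern _ _ _); last by rewrite invr_ge0 ltW.
rewrite -(natr1 m.+1) mulrDl mul1r divff ?gt_eqF //.
have : 0 <= m.+1%:R^-1 :> R by rewrite invr_ge0 ltW.
by move: (m.+1%:R^-1 : R) => y; lra.
Qed.

Lemma half_le_one_sub_inv_expn (m : nat) : (0 < m)%N ->
  2^-1 <= (1 - (2 * m%:R)^-1) ^+ m :> R.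
Proof.
move=> m0; set x : R := (2 * m%:R)^-1; have m0' : 0 < m%:R :> R by rewrite ltr0n.
have x0 : 0 < x by rewrite invr_gt0; lra.
have x1 : x <= 2^-1.
  by rewrite lef_pV2 ?posrE //; (have : 1 <= m%:R :> R by rewrite ler1n); lra.
suff h j : 1 - j%:R * x <= (1 - x) ^+ j.
  apply: le_trans (h m); have -> : m%:R * x = 2^-1 by rewrite /x; field; rewrite gt_eqF.
  lra.
elim: j => [|j IH]; first by rewrite expr0 mul0r subr0.
rewrite exprS; apply: le_trans (_ : (1 - x) * (1 - j%:R * x) <= _); last first.
  by rewrite ler_wpM2l //; lra.
rewrite -natr1; have : 0 <= x * (j%:R * x) by rewrite !mulr_ge0 // ltW.
lra.
Qed.

(** * Fourier analysis on V and the spectral gap of random translations *)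

Definition dot (k : nat) (p v : 'rV['F_2]_k) : 'F_2 := \sum_i p 0 i * v 0 i.

Definition chi (k : nat) (p v : 'rV['F_2]_k) : R := if dot p v == 0 then 1 else -1.

Lemma dotDr k (p v w : 'rV['F_2]_k) : dot p (v + w) = dot p v + dot p w.
Proof. by rewrite /dot -big_split; apply: eq_bigr => i _; rewrite mxE mulrDr. Qed.

Lemma dotDl k (p q v : 'rV['F_2]_k) : dot (p + q) v = dot p v + dot q v.
Proof. by rewrite /dot -big_split; apply: eq_bigr => i _; rewrite mxE mulrDl. Qed.

Lemma dot0l k (v : 'rV['F_2]_k) : dot 0 v = 0.
Proof. by rewrite /dot big1 // => i _; rewrite mxE mul0r. Qed.

Lemma dot0r k (v : 'rV['F_2]_k) : dot v 0 = 0.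
Proof. by rewrite /dot big1 // => i _; rewrite mxE mulr0. Qed.

Lemma F2_eq1 (x : 'F_2) : x != 0 -> x = 1.
Proof. by case: x => [[|[|i]] lti] // _; apply: val_inj. Qed.

Lemma row2_addvv k (v : 'rV['F_2]_k) : v + v = 0.
Proof.
by apply/rowP => i; rewrite !mxE -mulr2n -mulr_natr pchar_Zp // mulr0.
Qed.

Lemma row2_addvK k (v w : 'rV['F_2]_k) : w + v + v = w.
Proof. by rewrite -addrA row2_addvv addr0. Qed.

Lemma sum_row_shift k (x : 'rV['F_2]_k) (F : 'rV['F_2]_k -> R) :
  \sum_v F (v + x) = \sum_v F v.
Proof.
by rewrite [RHS](reindex_inj (h := fun v => v + x)) //; exact: addIr.
Qed.

Lemma F2_sign_add (x y : 'F_2) :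
  (if x + y == 0 then 1 else -1) =
  (if x == 0 then 1 else -1) * (if y == 0 then 1 else -1) :> R.
Proof.
have [->|/F2_eq1->] := eqVneq x 0; first by rewrite add0r mul1r.
have [->|/F2_eq1->] := eqVneq y 0; first by rewrite addr0 oner_eq0 mulr1.
by rewrite mulrNN mulr1.
Qed.

Lemma chiDr k (p v w : 'rV['F_2]_k) : chi p (v + w) = chi p v * chi p w.
Proof. by rewrite /chi dotDr F2_sign_add. Qed.

Lemma chiDl k (p q v : 'rV['F_2]_k) : chi (p + q) v = chi p v * chi q v.
Proof. by rewrite /chi dotDl F2_sign_add. Qed.

Lemma sum_chi k (v : 'rV['F_2]_k) :
  \sum_p chi p v = #|{: 'rV['F_2]_k}|%:R * (v == 0)%:R.
Proof.
have [->|v0] := eqVneq v 0.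
  by rewrite mulr1 /chi; under eq_bigr do rewrite dot0r eqxx; rewrite sumr_const.
rewrite mulr0; have [i vi0] : exists i, v 0 i != 0.
  apply/existsP; apply: contraNT v0; rewrite negb_exists => /forallP h.
  by apply/eqP/rowP => j; apply/eqP; have := h j; rewrite negbK mxE.
have e : dot (delta_mx 0 i) v != 0.
  rewrite /dot (bigD1 i) //= big1 => [|j ji]; last by rewrite mxE (negPf ji) andbF mul0r.
  by rewrite mxE !eqxx mul1r addr0.
(* Translating [p] by a basis vector that pairs nontrivially with [v] negates the sum, so the sum is
   zero. *)
have := sum_row_shift (delta_mx 0 i) (fun p => chi p v).
under eq_bigr => p _ do rewrite chiDl {2}/chi (negPf e).
rewrite -mulr_suml; lra.
Qed.

Definition fourier k (u : 'rV['F_2]_k -> R) (p : 'rV['F_2]_k) : R :=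
  \sum_v u v * chi p v.

Lemma parseval k (u : 'rV['F_2]_k -> R) :
  \sum_p fourier u p ^+ 2 = #|{: 'rV['F_2]_k}|%:R * \sum_v u v ^+ 2.
Proof.
transitivity (\sum_p \sum_v \sum_w u v * u w * chi p (v + w)).
  apply: eq_bigr => p _; rewrite expr2 /fourier mulr_suml; apply: eq_bigr => v _.
  by rewrite mulr_sumr; apply: eq_bigr => w _; rewrite chiDr; lra.
rewrite exchange_big mulr_sumr; apply: eq_bigr => v _; rewrite exchange_big /=.
rewrite (bigD1 v) //= [X in _ + X]big1 => [|w wv].
  by rewrite -mulr_sumr sum_chi row2_addvv eqxx /=; lra.
rewrite -mulr_sumr sum_chi; case: eqP => [vw|]; last by rewrite !mulr0.
by case/eqP: wv; rewrite -[w](row2_addvK v) [w + v]addrC vw add0r.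
Qed.

Lemma fourier_diff k (u : 'rV['F_2]_k -> R) (x p : 'rV['F_2]_k) :
  fourier (fun v => u v - u (v + x)) p = (1 - chi p x) * fourier u p.
Proof.
rewrite /fourier mulrBl mul1r.
have -> : chi p x * \sum_v u v * chi p v = \sum_v u (v + x) * chi p v.
  rewrite -(sum_row_shift x (fun v => u v * chi p v)) mulr_sumr.
  apply: eq_bigr => v _; rewrite chiDr.
  have : chi p x * chi p x = 1 by rewrite /chi; case: ifP; lra.
  by move: (chi p x) => c c2; rewrite -[RHS]mul1r -c2; lra.
by rewrite -sumrB; apply: eq_bigr => v _; rewrite mulrBl.
Qed.

Lemma sum_sqr_sub_mean (T : finType) (u : T -> R) : (0 < #|T|)%N ->
  #|T|%:R * \sum_v (u v - (\sum_w u w) / #|T|%:R) ^+ 2 =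
  #|T|%:R * (\sum_v u v ^+ 2) - (\sum_v u v) ^+ 2.
Proof.
move=> T0; set S := \sum_w u w; set c : R := #|T|%:R.
have c0 : c != 0 by rewrite pnatr_eq0 -lt0n.
under eq_bigr => v _ do rewrite sqrrB.
rewrite big_split /= sumrB /= -mulr_suml sumr_const.
under [X in _ - X + _]eq_bigr => v _ do rewrite -mulr_natl.
rewrite -mulr_sumr -mulr_suml -/S -[_ *+ #|_|]mulr_natl -/c.
by field.
Qed.

(** In Fourier space, translation by [x i] multiplies the squared coefficient of its difference at
    [p] by [(1 - chi p (x i)) ^+ 2], which is 4 or 0. Each nonzero frequency thus collects at least
    [4 * M], and the frequency 0 is the mean that the variance removes. *)
Lemma poincare_row2 k (I : finType) (P : pred I) (x : I -> 'rV['F_2]_k)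
    (M : nat) (u : 'rV['F_2]_k -> R) :
  (forall p, p != 0 -> (M <= #|[pred i | P i & (dot p (x i) != 0)%R]|)%N) ->
  4 * M%:R * \sum_v (u v - (\sum_w u w) / #|{: 'rV['F_2]_k}|%:R) ^+ 2
  <= \sum_(i | P i) \sum_v (u v - u (v + x i)) ^+ 2.
Proof.
move=> hM; set c : R := #|_|%:R.
have c0 : 0 < c by rewrite ltr0n; apply/card_gt0P; exists 0.
have par w : \sum_p fourier w p ^+ 2 = c * \sum_v w v ^+ 2 := parseval w.
rewrite -(ler_pM2l c0) mulrCA sum_sqr_sub_mean; last by rewrite -(ltr0n R).
rewrite [X in _ <= X]mulr_sumr; under [X in _ <= X]eq_bigr => i _ do rewrite -par.
rewrite -par [X in _ <= X]exchange_big /= [X in _ <= X](bigD1 0) //=.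
have F0 : fourier u 0 = \sum_v u v.
  by apply: eq_bigr => v _; rewrite /chi dot0l eqxx mulr1.
rewrite [X in 4 * _ * (X - _)](bigD1 0) //= F0 [_ + _ - _]addrAC subrr add0r.
have h0 : 0 <= \sum_(i | P i) fourier (fun v => u v - u (v + x i)) 0 ^+ 2.
  by apply: sumr_ge0 => i _; rewrite sqr_ge0.
apply: ler_wpDl => //; rewrite mulr_sumr; apply: ler_sum => p p0.
under eq_bigr => i _ do rewrite fourier_diff exprMn.
rewrite -mulr_suml ler_wpM2r ?sqr_ge0 //.
have -> : \sum_(i | P i) (1 - chi p (x i)) ^+ 2 =
          \sum_(i | P i && (dot p (x i) != 0)) (4 : R).
  rewrite [RHS]big_mkcondr; apply: eq_bigr => i _; rewrite /chi.
  by case: eqP => _ /=; rewrite expr2; lra.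
by rewrite sumr_const -[4 *+ _]mulr_natr ler_wpM2l // ler_nat hM.
Qed.

(** * Entropy on one fibre: Jensen, a logarithmic Sobolev bound, the one-step decrement *)

Lemma xlnx_jensen (T : finType) (P : pred T) (g : T -> R) (m : R) :
  (0 < #|P|)%N -> (forall v, 0 < g v) -> \sum_(v | P v) g v = #|P|%:R * m ->
  #|P|%:R * (m * ln m) <= \sum_(v | P v) g v * ln (g v).
Proof.
move=> P0 g0 em; have c0 : 0 < #|P|%:R :> R by rewrite ltr0n.
have m0 : 0 < m.
  rewrite -(pmulr_rgt0 _ c0) -em; case/card_gt0P: P0 => v Pv.
  rewrite (bigD1 v) //=; apply: ltr_wpDr => //; apply: sumr_ge0 => w _; exact: ltW.
have : \sum_(v | P v) (g v - m) <= \sum_(v | P v) (g v * ln (g v) - g v * ln m).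
  by apply: ler_sum => v _; exact: xlnx_ge_tangent.
rewrite !sumrB -mulr_suml sumr_const em -[m *+ _]mulr_natl.
by rewrite subrr subr_ge0 -mulrA.
Qed.

(** No value of [g] exceeds [c] times the mean, so [xlnx_le_sqr] applies with [K = c]. Replacing the
    centre [sqrt m] by the mean [s] of the square roots costs a factor 2, because [s <= sqrt m] by
    Cauchy-Schwarz. *)
Lemma logsob_row2 k (g : 'rV['F_2]_k -> R) (c m s : R) :
  (forall v, 0 < g v) -> c = #|{: 'rV['F_2]_k}|%:R ->
  \sum_v g v = c * m -> \sum_v Num.sqrt (g v) = c * s ->
  \sum_v (g v * ln (g v) - g v * ln m)
  <= (10 + 8 * ln c) * \sum_v (Num.sqrt (g v) - s) ^+ 2.
Proof.
move=> g0 ec eg es.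
have cN0 : (0 < #|{: 'rV['F_2]_k}|)%N by apply/card_gt0P; exists 0.
have c1 : 1 <= c by rewrite ec ler1n.
have c0 : 0 < c by rewrite ec ltr0n.
have gle v : g v <= c * m.
  by rewrite -eg (bigD1 v) //= lerDl sumr_ge0 // => w _; exact: ltW.
have m0 : 0 < m by have := gle 0; have := g0 0; move=> /lt_le_trans h /h; rewrite pmulr_rgt0.
have s0 : 0 <= s.
  by rewrite -(pmulr_rge0 _ c0) -es sumr_ge0 // => v _; exact: sqrtr_ge0.
have lnc0 : 0 <= ln c by rewrite -ln_one ler_ln.
set r := Num.sqrt m; have r0 : 0 < r by rewrite sqrtr_gt0.
have r2 : r * r = m by rewrite -expr2 sqr_sqrtr // ltW.
have eQ : \sum_v Num.sqrt (g v) ^+ 2 = c * m.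
  by rewrite -eg; apply: eq_bigr => v _; rewrite sqr_sqrtr // ltW.
have h1 : \sum_v (g v * ln (g v) - g v * ln m) <=
          (5 + 4 * ln c) * \sum_v (Num.sqrt (g v) - r) ^+ 2.
  rewrite mulr_sumr; apply: (@le_trans _ _
    (\sum_v (g v * ln (g v) - g v * ln m - g v + m))); last first.
    by apply: ler_sum => v _; exact: xlnx_le_sqr.
  rewrite [X in _ <= X]big_split /= [X in _ <= X + _]sumrB sumr_const eg.
  by rewrite -[m *+ _]mulr_natl -ec; lra.
have h2 : \sum_v (Num.sqrt (g v) - s) ^+ 2 = c * m - c * s ^+ 2.
  apply: (mulfI (lt0r_neq0 c0));
  have es' : s = (\sum_v Num.sqrt (g v)) / #|{: 'rV['F_2]_k}|%:R.
    by rewrite es -ec mulrC mulKf ?lt0r_neq0.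
  by rewrite {1}es' {1}ec sum_sqr_sub_mean // eQ es -ec; lra.
have h3 : \sum_v (Num.sqrt (g v) - r) ^+ 2 = 2 * (c * m) - 2 * c * r * s.
  under eq_bigr => v _ do rewrite sqrrB -mulr_natr.
  rewrite big_split /= sumrB /= eQ sumr_const -!mulr_suml es.
  by rewrite -[r ^+ 2 *+ _]mulr_natl -ec (expr2 r) r2; lra.
apply: le_trans h1 _; rewrite h2 h3.
have -> : (10 + 8 * ln c) * (c * m - c * s ^+ 2) =
  (5 + 4 * ln c) * (2 * (c * m - c * s ^+ 2)) by lra.
apply: ler_wpM2l; first by lra.
have sr : s <= r.
  rewrite -(ler_pXn2r (n := 2)) ?nnegrE ?(ltW r0) // -(ler_pM2l c0).
  rewrite (expr2 r) r2 -subr_ge0 -h2 sumr_ge0 // => v _; exact: sqr_ge0.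
rewrite -subr_ge0; have -> : 2 * (c * m - c * s ^+ 2) - (2 * (c * m) - 2 * c * r * s)
  = 2 * c * (s * (r - s)) by rewrite expr2; lra.
by rewrite !mulr_ge0 ?subr_ge0 // ltW.
Qed.

Definition xlnx (x : R) : R := x * ln x.

(** The chain of estimates is: entropy of [g], at most a multiple of the variance of its square root
    (logarithmic Sobolev), at most a multiple of the Dirichlet form [D] (Poincare), at most the
    entropy lost in the step. *)
Lemma fibre_entropy_decrement k (I : finType) (P : pred I) (x : I -> 'rV['F_2]_k)
    (M : nat) (g : 'rV['F_2]_k -> R) (c m : R) :
  (0 < #|P|)%N -> (forall v, 0 < g v) ->
  c = #|{: 'rV['F_2]_k}|%:R -> \sum_v g v = c * m ->
  (forall p, p != 0 -> (M <= #|[pred i | P i & (dot p (x i) != 0)%R]|)%N) ->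
  M%:R / #|P|%:R * \sum_v (g v * ln (g v) - g v * ln m)
  <= (10 + 8 * ln c) * (\sum_v xlnx (g v) -
     \sum_v xlnx ((\sum_(i | P i) (g v + g (v + x i)) / 2) / #|P|%:R)).
Proof.
move=> P0 g0 ec eg hM; have p0 : 0 < #|P|%:R :> R by rewrite ltr0n.
have c1 : 1 <= c by rewrite ec ler1n; apply/card_gt0P; exists 0.
have lnc0 : 0 <= ln c by rewrite -ln_one ler_ln.
set s := (\sum_v Num.sqrt (g v)) / c.
have es : \sum_v Num.sqrt (g v) = c * s.
  by rewrite /s mulrC divfK // lt0r_neq0 //; lra.
have hL := logsob_row2 g0 ec eg es.
have hP := poincare_row2 (fun v => Num.sqrt (g v)) hM.
rewrite -ec -/s in hP.
set D := \sum_(i | P i) _ in hP; set E := \sum_v _ in hP hL *.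
(* Jensen over [i] reduces the averaged update to single translations; each of them gains its share
   of [D] by [xlnx_midpoint]. *)
have key : #|P|%:R * \sum_v xlnx ((\sum_(i | P i) (g v + g (v + x i)) / 2) / #|P|%:R)
    <= #|P|%:R * \sum_v xlnx (g v) - D / 4.
  apply: (@le_trans _ _ (\sum_v \sum_(i | P i) xlnx ((g v + g (v + x i)) / 2))).
    rewrite mulr_sumr; apply: ler_sum => v _; apply: xlnx_jensen => //.
      by move=> i; apply: divr_gt0 => //; apply: addr_gt0.
    by rewrite mulrC divfK // lt0r_neq0.
  rewrite exchange_big /= /D mulr_suml mulr_natl -sumr_const -sumrB.
  apply: ler_sum => i _.
  have -> : \sum_v xlnx (g v) = \sum_v (xlnx (g v) + xlnx (g (v + x i))) / 2.
    by rewrite -mulr_suml big_split /= (sum_row_shift _ (fun v => xlnx (g v))); lra.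
  rewrite mulr_suml -sumrB; apply: ler_sum => v _.
  by have := xlnx_midpoint (g0 v) (g0 (v + x i)); rewrite /xlnx; lra.
set A := \sum_v xlnx (g v) in key *; set B := \sum_v xlnx _ in key *.
have h1 : M%:R * E <= #|P|%:R * (A - B) by lra.
rewrite -(ler_pM2l p0).
have -> : #|P|%:R * (M%:R / #|P|%:R * \sum_v (g v * ln (g v) - g v * ln m)) =
   M%:R * \sum_v (g v * ln (g v) - g v * ln m) by field; rewrite lt0r_neq0.
apply: (@le_trans _ _ (M%:R * ((10 + 8 * ln c) * E))); first exact: ler_wpM2l.
rewrite mulrCA [X in _ <= X]mulrCA; apply: ler_wpM2l => //; lra.
Qed.

(** * Site averages and subadditivity of entropy on V^n *)

Section Sites.
Variables n k : nat.
Implicit Types (z : config n k) (f h : config n k -> R) (b : 'I_n) (v : 'rV['F_2]_k).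

(** A fibre is parametrised by the displacement from [z b], so that [move z a b] is
    [shift z b (z a)]. *)
Definition shift z b v : config n k := [ffun i => if i == b then z b + v else z i].

Lemma shiftD z b v w : shift (shift z b v) b w = shift z b (v + w).
Proof. by apply/ffunP => i; rewrite !ffunE eqxx; case: eqP => // _; rewrite addrA. Qed.

Lemma shift0 z b : shift z b 0 = z.
Proof. by apply/ffunP => i; rewrite ffunE addr0; case: eqP => [->|]. Qed.

Lemma shiftC z b b' v w : b != b' ->
  shift (shift z b v) b' w = shift (shift z b' w) b v.
Proof.
move=> bb'; apply/ffunP => i; rewrite !ffunE (negPf bb') [b' == b]eq_sym (negPf bb').
by have [->|//] := eqVneq i b; rewrite (negPf bb').
Qed.

Lemma shift_id_ne z b v (i : 'I_n) : i != b -> shift z b v i = z i.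
Proof. by move=> ib; rewrite ffunE (negPf ib). Qed.

Lemma sum_shift b v f : \sum_z f (shift z b v) = \sum_z f z.
Proof.
rewrite [RHS](reindex_inj (h := fun z => shift z b v)) //.
by apply: (can_inj (g := fun z => shift z b v)) => z; rewrite shiftD row2_addvv shift0.
Qed.

(** The conditional expectation given all coordinates but [b], under the uniform law on V^n. *)
Definition avg_site b f z : R := (\sum_v f (shift z b v)) / #|{: 'rV['F_2]_k}|%:R.

Definition site_invariant b f := forall z v, f (shift z b v) = f z.

Lemma card_row2_gt0 : 0 < #|{: 'rV['F_2]_k}|%:R :> R.
Proof. by rewrite ltr0n; apply/card_gt0P; exists 0. Qed.

Lemma avg_site_gt0 b f : (forall z, 0 < f z) -> forall z, 0 < avg_site b f z.
Proof.
move=> f0 z; apply: divr_gt0; last exact: card_row2_gt0.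
by rewrite (bigD1 0) //=; apply: ltr_wpDr => //; apply: sumr_ge0 => v _; exact: ltW.
Qed.

Lemma avg_site_invariant b f : site_invariant b (avg_site b f).
Proof.
move=> z v; congr (_ / _); rewrite -[RHS](sum_row_shift v).
by apply: eq_bigr => w _; rewrite shiftD addrC.
Qed.

Lemma avg_site_keeps_invariant b b' f :
  site_invariant b f -> site_invariant b (avg_site b' f).
Proof.
move=> fb; have [<-|bb'] := eqVneq b b'; first exact: avg_site_invariant.
by move=> z v; congr (_ / _); apply: eq_bigr => w _; rewrite shiftC.
Qed.

Lemma sum_fibres b f : \sum_z f z =
  (\sum_z \sum_v f (shift z b v)) / #|{: 'rV['F_2]_k}|%:R.
Proof.
rewrite exchange_big /=; under [X in _ = X / _]eq_bigr => v _ do rewrite (sum_shift b v f).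
by rewrite sumr_const -[_ *+ #|_|]mulr_natr mulfK // lt0r_neq0 ?card_row2_gt0.
Qed.

Lemma sum_mul_avg_site b f h : site_invariant b h ->
  \sum_z avg_site b f z * h z = \sum_z f z * h z.
Proof.
move=> hb; rewrite [RHS](sum_fibres b) mulr_suml; apply: eq_bigr => z _.
rewrite mulrAC mulr_suml; congr (_ / _).
by apply: eq_bigr => v _; rewrite hb.
Qed.

Lemma sum_avg_site b f : \sum_z avg_site b f z = \sum_z f z.
Proof.
have := @sum_mul_avg_site b f (fun=> 1) (fun _ _ => erefl).
by under eq_bigr do rewrite mulr1; under [RHS]eq_bigr do rewrite mulr1.
Qed.

(** The conditional entropy of coordinate [b] given the others, as an unnormalised sum over
    configurations. *)
Definition site_entropy b f : R :=
  \sum_z (f z * ln (f z) - f z * ln (avg_site b f z)).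

(* Relative to [b]-averages, [f] itself maximises [E f (ln F - ln (avg_site b F))] over [F]. *)
Lemma site_entropy_variational b f h :
  (forall z, 0 < f z) -> (forall z, 0 < h z) ->
  \sum_z (f z * ln (h z) - f z * ln (avg_site b h z)) <= site_entropy b f.
Proof.
move=> f0 h0; have af0 := avg_site_gt0 b f0; have ah0 := avg_site_gt0 b h0.
(* The function [h * avg f / avg h] has the same total mass as [f], so the linear terms of the
   tangent inequality cancel. *)
have e : \sum_z h z * (avg_site b f z / avg_site b h z) = \sum_z f z.
  rewrite -(sum_mul_avg_site (b := b)); last by move=> z v; rewrite !avg_site_invariant.
  rewrite -(sum_avg_site b f); apply: eq_bigr => z _.
  by rewrite mulrC divfK // lt0r_neq0.
rewrite -subr_ge0 -sumrB -[X in X <= _](subrr (\sum_z f z)) -{2}e -sumrB.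
apply: ler_sum => z _.
have m0 := mulr_gt0 (h0 z) (divr_gt0 (af0 z) (ah0 z)).
have := xlnx_ge_tangent (f0 z) m0.
by rewrite (lnM (h0 z) (divr_gt0 (af0 z) (ah0 z))) (ln_div (af0 z) (ah0 z)); lra.
Qed.

(** A telescoping sum: averaging out one more site [b] adds the increment of
    [ln F - ln (avg_site b F)] against [f], which the variational principle bounds by the site
    entropy of [f] itself. *)
Lemma entropy_le_sum_site_entropy_seq f (s : seq 'I_n) : (forall z, 0 < f z) ->
  \sum_z (f z * ln (f z) - f z * ln (foldr avg_site f s z))
  <= \sum_(b <- s) site_entropy b f.
Proof.
move=> f0; elim: s => [|b s IH] /=.
  by rewrite big_nil big1 // => z _; rewrite subrr.
have F0 : forall z, 0 < foldr avg_site f s z.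
  by elim: (s) => [|a l IHl] //=; exact: avg_site_gt0.
have := site_entropy_variational b f0 F0; rewrite big_cons.
set F := foldr avg_site f s in F0 IH *; move=> hb.
apply: le_trans (lerD hb IH); rewrite -big_split /=; apply: ler_sum => z _; lra.
Qed.

Lemma all_sites_invariant_const f : (forall b, site_invariant b f) ->
  forall z z', f z = f z'.
Proof.
(* In characteristic 2 the displacement [z b + z' b] turns [z b] into [z' b]; coordinates are
   exchanged one at a time. *)
move=> finv z z'; pose go (s : seq 'I_n) := foldr (fun b y => shift y b (z b + z' b)) z s.
have fgo s : f (go s) = f z by elim: s => //= b s IH; rewrite finv.
rewrite -(fgo (enum 'I_n)); congr f; apply/ffunP => i.
suff h s : uniq s -> go s i = if i \in s then z' i else z i.
  by rewrite h ?enum_uniq // mem_enum.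
elim: s => [|b s IH] //= /andP[bs us]; rewrite inE ffunE.
have [ib|ib] := eqVneq i b; last by rewrite IH.
rewrite -ib; have : i \notin s by rewrite ib.
by move=> /negPf his; rewrite IH // his addrA row2_addvv add0r.
Qed.

(** Subadditivity: once every site is averaged out, the density is constant, hence 1 by
    normalisation, and its logarithm drops out of the telescoped bound. *)
Lemma entropy_le_sum_site_entropy f : (forall z, 0 < f z) ->
  \sum_z f z = #|{: config n k}|%:R ->
  \sum_z xlnx (f z) <= \sum_b site_entropy b f.
Proof.
move=> f0 ef; have := entropy_le_sum_site_entropy_seq (enum 'I_n) f0.
rewrite big_enum /=; set F := foldr _ _ _.
have Finv b : site_invariant b F.
  have : b \in enum 'I_n by rewrite mem_enum.
  rewrite /F; elim: (enum _) => //= a l IH; rewrite inE => /orP[/eqP->|/IH].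
    exact: avg_site_invariant.
  exact: avg_site_keeps_invariant.
have eF : \sum_z F z = #|{: config n k}|%:R.
  by rewrite -ef /F; elim: (enum _) => //= a l IH; rewrite sum_avg_site.
have F1 z : F z = 1.
  have c0 : #|{: config n k}|%:R != 0 :> R.
    by rewrite pnatr_eq0 -lt0n; apply/card_gt0P; exists z.
  apply: (mulfI c0); rewrite mulr1 -[RHS]eF mulr_natl -sumr_const.
  by apply: eq_bigr => y _; exact: all_sites_invariant_const.
by under eq_bigr => z _ do rewrite F1 ln_one mulr0 subr0.
Qed.

End Sites.

(** * The modified chain: entropy contraction and comparison with the lazy chain *)

Section ModifiedChain.
Variables n k M : nat.
Implicit Types (z : config n k) (f h u w : config n k -> R) (b a : 'I_n).
Hypothesis n_gt1 : (1 < n)%N.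

Lemma card_others b : #|[pred a | a != b]| = n.-1.
Proof. by rewrite cardC1 card_ord. Qed.

Let n1_gt0 : 0 < n.-1%:R :> R.
Proof. by rewrite ltr0n -subn1 subn_gt0. Qed.

Let n_gt0 : 0 < n%:R :> R.
Proof. by rewrite ltr0n ltnW. Qed.

Lemma sum_sites_const (y : R) : \sum_(b < n) y = n%:R * y.
Proof. by rewrite sumr_const card_ord mulr_natl. Qed.

Definition site_lazy b f z : R :=
  (\sum_(a | a != b) (f z + f (shift z b (z a))) / 2) / n.-1%:R.

(** Leaving [b] out of the count makes [good b] constant on the fibres of site [b], so each fibre is
    updated by one rule. *)
Definition good b z : bool :=
  [forall p, (p != 0) ==> (M <= #|[pred a | (a != b) & (dot p (z a) != 0)%R]|)%N].

(** All indices are counted, and equality with [M] is allowed: this absorbs the index left out in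
    [good], so one event covers all sites. *)
Definition bad z : bool :=
  [exists p, (p != 0) && (#|[pred a | (dot p (z a) != 0)%R]| <= M)%N].

(* If the other sites do not drive a fast walk on the fibre over them, the site is resampled. *)
Definition site_mod b f z : R :=
  if good b z then site_lazy b f z else avg_site b f z.

Definition chain_lazy f z : R := (\sum_b site_lazy b f z) / n%:R.

Definition chain_mod f z : R := (\sum_b site_mod b f z) / n%:R.

Lemma good_shift b z v : good b (shift z b v) = good b z.
Proof.
apply: eq_forallb => p; congr (_ ==> (_ <= _)%N).
by apply: eq_card => a; rewrite !inE; case: eqVneq => //= ab; rewrite shift_id_ne.
Qed.

Lemma not_good_bad b z : ~~ good b z -> bad z.
Proof.
rewrite negb_forall => /existsP[p]; rewrite negb_imply -ltnNge => /andP[p0 h].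
apply/existsP; exists p; rewrite p0 /=; apply: leq_trans h.
rewrite (cardD1 b); apply: leq_add (leq_b1 _) _.
by apply: subset_leq_card; apply/subsetP => a; rewrite !inE.
Qed.

Lemma shift_site_involutive a b : a != b -> involutive (fun z => shift z b (z a)).
Proof. by move=> ab z; rewrite shift_id_ne // shiftD row2_addvv shift0. Qed.

Lemma sum_mul_shift_site a b f h : a != b ->
  \sum_z f (shift z b (z a)) * h z = \sum_z f z * h (shift z b (z a)).
Proof.
move=> ab; have inv := shift_site_involutive ab.
rewrite [RHS](reindex_inj (h := fun z => shift z b (z a))) /=; last exact: inv_inj.
by apply: eq_bigr => z _; rewrite inv.
Qed.

Lemma site_lazy_sym b f h :
  \sum_z site_lazy b f z * h z = \sum_z f z * site_lazy b h z.
Proof.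
transitivity (\sum_z \sum_(a | a != b)
    (f z * h z + f (shift z b (z a)) * h z) / 2 / n.-1%:R).
  apply: eq_bigr => z _; rewrite /site_lazy mulrAC !mulr_suml.
  by apply: eq_bigr => a _; lra.
transitivity (\sum_z \sum_(a | a != b)
    (f z * h z + f z * h (shift z b (z a))) / 2 / n.-1%:R); last first.
  apply: eq_bigr => z _; rewrite /site_lazy mulrA mulr_sumr mulr_suml.
  by apply: eq_bigr => a _; lra.
rewrite exchange_big [RHS]exchange_big; apply: eq_bigr => a ab.
by rewrite -!mulr_suml !big_split /= sum_mul_shift_site.
Qed.

Lemma site_lazy_invariant b h z : site_invariant b h -> site_lazy b h z = h z.
Proof.
move=> hb; rewrite /site_lazy; under eq_bigr => a _ do rewrite hb.
rewrite sumr_const card_others -[_ *+ _]mulr_natr mulfK ?lt0r_neq0 //; lra.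
Qed.

Lemma sum_mul_site_lazy b f h : site_invariant b h ->
  \sum_z site_lazy b f z * h z = \sum_z f z * h z.
Proof.
by move=> hb; rewrite site_lazy_sym; apply: eq_bigr => z _; rewrite site_lazy_invariant.
Qed.

Lemma site_mod_split b f z : site_mod b f z =
  site_lazy b f z * (good b z)%:R + avg_site b f z * (~~ good b z)%:R.
Proof. by rewrite /site_mod; case: ifP => _ /=; lra. Qed.

Lemma sum_site_mod b f : \sum_z site_mod b f z = \sum_z f z.
Proof.
under eq_bigr do rewrite site_mod_split.
rewrite big_split /= (sum_mul_site_lazy f (h := fun z => (good b z)%:R)); last first.
  by move=> z v; rewrite good_shift.
rewrite (sum_mul_avg_site f (h := fun z => (~~ good b z)%:R)); last first.
  by move=> z v; rewrite good_shift.
by rewrite -big_split; apply: eq_bigr => z _ /=; case: good => /=; lra.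
Qed.

Lemma site_lazy_gt0 b f : (forall z, 0 < f z) -> forall z, 0 < site_lazy b f z.
Proof.
move=> f0 z; apply: divr_gt0 => //.
have /card_gt0P[a ab] : (0 < #|[pred a | a != b]|)%N by rewrite card_others -subn1 subn_gt0.
rewrite (bigD1 a) //=; apply: ltr_wpDr; last by have := f0 z; have := f0 (shift z b (z a)); lra.
by apply: sumr_ge0 => i _; have := f0 z; have := f0 (shift z b (z i)); lra.
Qed.

Lemma site_lazy_ge0 b f : (forall z, 0 <= f z) -> forall z, 0 <= site_lazy b f z.
Proof.
move=> f0 z; apply: divr_ge0; last exact: ltW.
by apply: sumr_ge0 => i _; have := f0 z; have := f0 (shift z b (z i)); lra.
Qed.

Lemma avg_site_ge0 b f : (forall z, 0 <= f z) -> forall z, 0 <= avg_site b f z.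
Proof. by move=> f0 z; apply: divr_ge0 => //; apply: sumr_ge0. Qed.

Lemma site_mod_gt0 b f : (forall z, 0 < f z) -> forall z, 0 < site_mod b f z.
Proof.
by move=> f0 z; rewrite /site_mod; case: ifP => _; [exact: site_lazy_gt0 | exact: avg_site_gt0].
Qed.

Lemma chain_mod_gt0 f : (forall z, 0 < f z) -> forall z, 0 < chain_mod f z.
Proof.
move=> f0 z; apply: divr_gt0 => //.
rewrite (bigD1 (Ordinal n_gt1)) //=; apply: ltr_wpDr; last exact: site_mod_gt0.
by apply: sumr_ge0 => b _; apply/ltW/site_mod_gt0.
Qed.

Lemma chain_lazy_ge0 f : (forall z, 0 <= f z) -> forall z, 0 <= chain_lazy f z.
Proof.
move=> f0 z; apply: divr_ge0; last exact: ltW.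
by apply: sumr_ge0 => b _; exact: site_lazy_ge0.
Qed.

Lemma sum_chain_mod f : \sum_z chain_mod f z = \sum_z f z.
Proof.
rewrite -mulr_suml exchange_big; under eq_bigr do rewrite sum_site_mod.
by rewrite sumr_const card_ord -[_ *+ _]mulr_natr mulfK // lt0r_neq0.
Qed.

(** The bound holds fibre by fibre. On a good fibre it is [fibre_entropy_decrement]; on any other,
    resampling removes the whole fibre entropy, and [e <= 1]. *)
Lemma site_mod_entropy (e : R) b f : (forall z, 0 < f z) ->
  0 <= e <= 1 ->
  e * (10 + 8 * ln #|{: 'rV['F_2]_k}|%:R) * n%:R <= M%:R ->
  e * site_entropy b f <= \sum_z xlnx (f z) - \sum_z xlnx (site_mod b f z).
Proof.
move=> f0 /andP[e0 e1] eM.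
rewrite /site_entropy mulr_sumr -sumrB -subr_ge0 -sumrB.
rewrite (sum_fibres b) divr_ge0 ?(ltW (card_row2_gt0 k)) // sumr_ge0 // => z _.
rewrite sumrB subr_ge0.
set c : R := #|_|%:R in eM *; have c1 : 1 <= c.
  by rewrite ler1n; apply/card_gt0P; exists 0.
have c0 : 0 < c by lra.
have lnc0 : 0 <= ln c by rewrite -ln_one ler_ln.
pose g v := f (shift z b v); pose m := avg_site b f z.
have g0 v : 0 < g v by exact: f0.
have m0 : 0 < m by exact: avg_site_gt0.
have em : \sum_v g v = c * m by rewrite /m /avg_site mulrC divfK // lt0r_neq0.
set X := \sum_v (g v * ln (g v) - g v * ln m).
have X0 : 0 <= X.
  have <- : \sum_v (g v - m) = 0.
    by rewrite sumrB em sumr_const -[m *+ _]mulr_natl subrr.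
  by apply: ler_sum => v _; exact: xlnx_ge_tangent.
rewrite -mulr_sumr sumrB.
have -> : \sum_v (f (shift z b v) * ln (f (shift z b v))
      - f (shift z b v) * ln (avg_site b f (shift z b v))) = X.
  by apply: eq_bigr => v _; rewrite avg_site_invariant.
have [gd|bd] := boolP (good b z).
  have hM p : p != 0 ->
      (M <= #|[pred a | (a != b) & (dot p (z a) != 0)%R]|)%N.
    by move=> p0; move/forallP: gd => /(_ p); rewrite p0.
  have P0 : (0 < #|[pred a | a != b]|)%N by rewrite card_others -subn1 subn_gt0.
  have := fibre_entropy_decrement (P := [pred a | a != b]) (x := fun a => z a)
            P0 g0 erefl em hM.
  rewrite card_others -/c -/X.
  have -> : \sum_v xlnx (site_mod b f (shift z b v)) =
    \sum_v xlnx ((\sum_(a | a != b) (g v + g (v + z a)) / 2) / n.-1%:R).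
    apply: eq_bigr => v _; rewrite /site_mod good_shift gd; congr (xlnx (_ / _)).
    by apply: eq_bigr => a ab; rewrite shiftD shift_id_ne.
  set Y := _ - _; rewrite -/(g _) => hY.
  have d0 : 0 < 10 + 8 * ln c by lra.
  have hMX : M%:R * X <= n.-1%:R * ((10 + 8 * ln c) * Y).
    by move: hY; rewrite mulrAC ler_pdivrMr // [_ * n.-1%:R]mulrC.
  rewrite -(ler_pM2l (mulr_gt0 n1_gt0 d0)) -[X in _ <= X]mulrA.
  apply: le_trans hMX; apply: (@le_trans _ _ ((e * (10 + 8 * ln c) * n%:R) * X)).
    have : n.-1%:R <= n%:R :> R by rewrite ler_nat leq_pred.
    move/(ler_wpM2r (mulr_ge0 (mulr_ge0 e0 (ltW d0)) X0)); lra.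
  exact: ler_wpM2r.
apply: (@le_trans _ _ X); first by rewrite ler_piMl.
rewrite /X sumrB lerD2l lerN2 /site_mod.
under [X in X <= _]eq_bigr => v _ do rewrite good_shift (negPf bd) avg_site_invariant.
rewrite sumr_const -[_ *+ _]mulr_natl -/c -mulr_suml em /xlnx -/m; lra.
Qed.

(** Convexity passes from the average over [b] to the single updates, whose gains add up to at least
    [e] times the total entropy by subadditivity. *)
Lemma chain_mod_entropy (e : R) f : (forall z, 0 < f z) ->
  \sum_z f z = #|{: config n k}|%:R ->
  0 <= e <= 1 ->
  e * (10 + 8 * ln #|{: 'rV['F_2]_k}|%:R) * n%:R <= M%:R ->
  \sum_z xlnx (chain_mod f z) <= (1 - e / n%:R) * \sum_z xlnx (f z).
Proof.
move=> f0 ef e01 eM; set S := \sum_z xlnx (f z).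
have h1 : n%:R * \sum_z xlnx (chain_mod f z) <= \sum_b \sum_z xlnx (site_mod b f z).
  rewrite exchange_big mulr_sumr /=; apply: ler_sum => z _.
  have := xlnx_jensen (P := predT) (g := fun b => site_mod b f z) (m := chain_mod f z).
  rewrite card_ord; apply; first exact: ltnW.
    by move=> b; exact: site_mod_gt0.
  by rewrite /chain_mod mulrC divfK // lt0r_neq0.
have h2 : \sum_b \sum_z xlnx (site_mod b f z) <= n%:R * S - e * S.
  apply: (@le_trans _ _ (\sum_b (S - e * site_entropy b f))).
    by apply: ler_sum => b _; have := site_mod_entropy b f0 e01 eM; rewrite -/S; lra.
  rewrite sumrB sumr_const card_ord mulr_natl lerD2l lerN2 -mulr_sumr.
  by case/andP: e01 => e0 _; apply: ler_wpM2l => //; exact: entropy_le_sum_site_entropy.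
rewrite -(ler_pM2l n_gt0); apply: le_trans h1 (le_trans h2 _).
by rewrite le_eqVlt; apply/orP; left; apply/eqP; field; rewrite lt0r_neq0.
Qed.

Lemma iter_chain_mod_entropy (e : R) t f : (forall z, 0 < f z) ->
  \sum_z f z = #|{: config n k}|%:R ->
  0 <= e <= 1 ->
  e * (10 + 8 * ln #|{: 'rV['F_2]_k}|%:R) * n%:R <= M%:R ->
  [/\ forall z, 0 < iter t chain_mod f z,
      \sum_z iter t chain_mod f z = #|{: config n k}|%:R &
      \sum_z xlnx (iter t chain_mod f z) <= (1 - e / n%:R) ^+ t * \sum_z xlnx (f z)].
Proof.
move=> f0 ef e01 eM; elim: t => [|t [p s h]]; first by split=> //; rewrite mul1r.
split=> /=; first exact: chain_mod_gt0.
  by rewrite sum_chain_mod.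
apply: le_trans (chain_mod_entropy p s e01 eM) _.
rewrite exprS -mulrA ler_wpM2l // subr_ge0 ler_pdivrMr // mul1r.
case/andP: e01 => _ /le_trans; apply; rewrite ler1n; exact: ltnW.
Qed.

Lemma sum_abs_site_mod b w : \sum_z `|site_mod b w z| <= \sum_z `|w z|.
Proof.
rewrite -[X in _ <= X](sum_site_mod b); apply: ler_sum => z _; rewrite /site_mod.
case: ifP => _; rewrite /site_lazy /avg_site normrM normfV normr_nat ler_wpM2r ?invr_ge0 //.
  apply: le_trans (ler_norm_sum _ _ _) _; apply: ler_sum => a _.
  by rewrite normrM normfV normr_nat ler_wpM2r ?invr_ge0 // ler_normD.
exact: ler_norm_sum.
Qed.

Lemma site_modB b u w z :
  site_mod b u z - site_mod b w z = site_mod b (fun y => u y - w y) z.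
Proof.
rewrite /site_mod; case: ifP => _; rewrite -mulrBl -sumrB; congr (_ / _).
by apply: eq_bigr => a _; lra.
Qed.

Lemma sum_abs_chain_modB u w :
  \sum_z `|chain_mod u z - chain_mod w z| <= \sum_z `|u z - w z|.
Proof.
rewrite -(ler_pM2l n_gt0) mulr_sumr.
apply: (@le_trans _ _ (\sum_z \sum_b `|site_mod b (fun y => u y - w y) z|)).
  apply: ler_sum => z _; rewrite -mulrBl -sumrB normrM normfV normr_nat.
  rewrite mulrC divfK ?lt0r_neq0 //.
  by under eq_bigr do rewrite site_modB; exact: ler_norm_sum.
rewrite exchange_big -sum_sites_const.
by apply: ler_sum => b _; exact: sum_abs_site_mod.
Qed.

(** The two updates at [b] differ only on fibres that are not good. Both preserve the mass of that
    union of fibres, and it lies inside [bad]; hence the factor 2. *)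
Lemma sum_abs_chain_lazy_mod u : (forall z, 0 <= u z) ->
  \sum_z `|chain_lazy u z - chain_mod u z| <= 2 * \sum_(z | bad z) u z.
Proof.
move=> u0; rewrite -(ler_pM2l n_gt0) mulr_sumr.
apply: (@le_trans _ _ (\sum_z \sum_b `|site_lazy b u z - site_mod b u z|)).
  apply: ler_sum => z _; rewrite -mulrBl -sumrB normrM normfV normr_nat.
  by rewrite mulrC divfK ?lt0r_neq0 // ler_norm_sum.
rewrite exchange_big -sum_sites_const.
apply: ler_sum => b _; pose h z : R := (~~ good b z)%:R.
have hb : site_invariant b h by move=> z v; rewrite /h good_shift.
apply: (@le_trans _ _ (\sum_z (site_lazy b u z * h z + avg_site b u z * h z))).
  apply: ler_sum => z _; rewrite /site_mod /h; case: ifP => _ /=.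
    by rewrite subrr normr0 !mulr0 addr0.
  rewrite !mulr1; apply: le_trans (ler_normB _ _) _.
  by rewrite !ger0_norm ?site_lazy_ge0 ?avg_site_ge0.
rewrite big_split /= sum_mul_site_lazy // sum_mul_avg_site //.
have : \sum_z u z * h z <= \sum_(z | bad z) u z.
  rewrite [X in _ <= X]big_mkcond; apply: ler_sum => z _; rewrite /h.
  have [gd|/not_good_bad->] := boolP (good b z); last by rewrite mulr1.
  by rewrite mulr0; case: ifP.
lra.
Qed.

Lemma iter_chain_lazy_ge0 t u : (forall z, 0 <= u z) ->
  forall z, 0 <= iter t chain_lazy u z.
Proof. by move=> u0; elim: t => //= t IH; exact: chain_lazy_ge0. Qed.

(** A Duhamel expansion: the modified chain is an L1 contraction, so one-step errors only add. They
    are measured along the lazy chain, so only its visits to [bad] have to be controlled. *)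
Lemma iter_chain_lazy_mod t u : (forall z, 0 <= u z) ->
  \sum_z `|iter t chain_lazy u z - iter t chain_mod u z|
  <= \sum_(s < t) 2 * \sum_(z | bad z) iter s chain_lazy u z.
Proof.
move=> u0; elim: t => [|t IH].
  by rewrite big_ord0 big1 // => z _; rewrite subrr normr0.
rewrite big_ord_recr /=; set L := iter t chain_lazy u; set A := iter t chain_mod u.
apply: (@le_trans _ _ (\sum_z (`|chain_mod L z - chain_mod A z|
    + `|chain_lazy L z - chain_mod L z|))).
  apply: ler_sum => z _; rewrite [X in _ <= X]addrC.
  by apply: le_trans (ler_normD _ _); rewrite addrA subrK.
rewrite big_split /=; apply: lerD; last first.
  by apply: sum_abs_chain_lazy_mod; exact: iter_chain_lazy_ge0.
exact: le_trans (sum_abs_chain_modB L A) IH.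
Qed.

End ModifiedChain.

(** * The lazy chain: transition powers as densities, symmetry, preservation of spanning *)

Section LazyChain.
Variables n k : nat.
Implicit Types (z x y : config n k) (f h u w : config n k -> R) (b a : 'I_n).
Implicit Types (p v : 'rV['F_2]_k).
Hypothesis n_gt1 : (1 < n)%N.

Let n1_gt0 : 0 < n.-1%:R :> R.
Proof. by rewrite ltr0n -subn1 subn_gt0. Qed.

Let n_gt0 : 0 < n%:R :> R.
Proof. by rewrite ltr0n ltnW. Qed.

Lemma moveK z a b : a != b -> move (move z a b) a b = z.
Proof. by move=> ab; exact: (shift_site_involutive ab). Qed.

(** Each move is its own inverse, so the sum over predecessors of [y] becomes a sum over the moves
    applied to [y]. *)
Lemma sum_mul_Pker u y :
  \sum_z u z * Pker z y =
  (\sum_b \sum_(a | a != b) u (shift y b (y a))) / (n * n.-1)%:R.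
Proof.
under eq_bigr do rewrite /Pker mulrA.
rewrite -mulr_suml; congr (_ / _).
transitivity (\sum_z \sum_(q : 'I_n * 'I_n | q.1 != q.2) u z * (z == move y q.1 q.2)%:R).
  apply: eq_bigr => z _; rewrite -sum1_card natr_sum mulr_sumr.
  rewrite [RHS]big_mkcond [LHS]big_mkcond; apply: eq_bigr => q _.
  rewrite inE; have [q12|//] := boolP (q.1 != q.2); rewrite /=.
  case: (eqVneq (move z q.1 q.2) y) => [<-|zy]; first by rewrite moveK ?eqxx.
  by case: eqP => [e|]; rewrite ?mulr0 //; case/eqP: zy; rewrite e moveK.
rewrite exchange_big /=.
rewrite -(pair_big_dep (fun=> true) (fun a b => a != b)
   (fun a b => \sum_z u z * (z == move y a b)%:R)) /=.
rewrite (exchange_big_dep (fun=> true)) //=; apply: eq_bigr => b _.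
apply: eq_bigr => a _; rewrite (bigD1 (move y a b)) //= eqxx mulr1 big1 ?addr0 //.
by move=> z /negPf->; rewrite mulr0.
Qed.

Lemma chain_lazy_split f z : chain_lazy f z = f z / 2 +
  (\sum_b \sum_(a | a != b) f (shift z b (z a))) / (2 * (n * n.-1)%:R).
Proof.
rewrite /chain_lazy /site_lazy -mulr_suml.
under eq_bigr => b _ do rewrite -mulr_suml big_split /= sumr_const card_others.
rewrite -mulr_suml big_split /= sumr_const card_ord -mulrnA -[_ *+ _]mulr_natr !natrM.
by field; rewrite !lt0r_neq0.
Qed.

Lemma sum_mul_Qker u y : \sum_z u z * Qker z y = chain_lazy u y.
Proof.
rewrite chain_lazy_split /Qker.
transitivity ((\sum_z u z * (z == y)%:R + \sum_z u z * Pker z y) / 2).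
  by rewrite -big_split mulr_suml; apply: eq_bigr => z _ /=; rewrite mulrA mulrDr.
rewrite sum_mul_Pker (bigD1 y) //= eqxx mulr1 big1 ?addr0; last first.
  by move=> z /negPf->; rewrite mulr0.
by rewrite natrM; field; rewrite !lt0r_neq0.
Qed.

(** The point mass at [x] as a density with respect to the uniform law on all of V^n. *)
Definition start x z : R := #|{: config n k}|%:R * (x == z)%:R.

Lemma card_config_gt0 : 0 < #|{: config n k}|%:R :> R.
Proof. by rewrite ltr0n; apply/card_gt0P; exists [ffun=> 0]. Qed.

Lemma Qpow_iter_chain_lazy t x y :
  Qpow t x y = iter t (@chain_lazy n k) (start x) y / #|{: config n k}|%:R.
Proof.
elim: t y => [|t IH] y /=.
  by rewrite /start mulrAC divff ?mul1r // lt0r_neq0 // card_config_gt0.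
under eq_bigr do rewrite IH mulrAC.
by rewrite -mulr_suml sum_mul_Qker.
Qed.

Lemma chain_lazy_sym f h :
  \sum_z chain_lazy f z * h z = \sum_z f z * chain_lazy h z.
Proof.
transitivity ((\sum_b \sum_z site_lazy b f z * h z) / n%:R).
  rewrite exchange_big mulr_suml; apply: eq_bigr => z _.
  by rewrite /chain_lazy mulrAC mulr_suml.
transitivity ((\sum_b \sum_z f z * site_lazy b h z) / n%:R).
  by congr (_ / _); apply: eq_bigr => b _; rewrite site_lazy_sym.
rewrite exchange_big mulr_suml; apply: eq_bigr => z _.
by rewrite /chain_lazy mulrA mulr_sumr.
Qed.

Lemma chain_lazy_le (K : R) f z :
  f z <= K -> (forall a b, a != b -> f (shift z b (z a)) <= K) -> chain_lazy f z <= K.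
Proof.
move=> fz fs; rewrite ler_pdivrMr // mulrC -sum_sites_const; apply: ler_sum => b _.
rewrite ler_pdivrMr // mulr_natr -(card_others b) -sumr_const; apply: ler_sum => a ab.
by have := fs a b ab; lra.
Qed.

Lemma sum_chain_lazy f : \sum_z chain_lazy f z = \sum_z f z.
Proof.
have := chain_lazy_sym f (fun=> 1).
under eq_bigr do rewrite mulr1; move=> ->; apply: eq_bigr => z _.
rewrite chain_lazy_split; under eq_bigr do rewrite sumr_const card_others.
rewrite sumr_const card_ord -mulrnA natrM mulnC natrM; field; rewrite !lt0r_neq0 //.
Qed.

(** The update multiplies the matrix of rows by [1 + delta_mx b a] on the left, which cannot raise
    the rank. Hence no mass ever reaches non-spanning configurations. *)
Lemma spans_shift_site z a b : spans (shift z b (z a)) -> spans z.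
Proof.
rewrite /spans; have -> : \matrix_(i < n) shift z b (z a) i =
    (1%:M + delta_mx b a) *m (\matrix_(i < n) z i).
  apply/matrixP => i j; rewrite mulmxDl mul1mx !mxE (bigD1 a) //= !mxE eqxx andbT.
  rewrite big1 => [|l /negPf la]; last by rewrite !mxE la andbF mul0r.
  rewrite addr0 ffunE; case: eqVneq => [->|_]; last by rewrite mul0r addr0.
  by rewrite mul1r mxE.
rewrite /row_full => /eqP h; rewrite eqn_leq rank_leq_col /= -{1}h.
exact: mxrankM_maxr.
Qed.

Lemma spans_dot_neq0 z p : spans z -> p != 0 -> exists a, dot p (z a) != 0.
Proof.
move=> /row_fullP[A hA] p0; apply/existsP; apply: contraNT p0.
rewrite negb_exists => /forallP h.
suff : p^T = 0 by move/(congr1 trmx); rewrite trmxK trmx0 => ->.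
rewrite -[p^T]mul1mx -hA -mulmxA [X in A *m X](_ : _ = 0) ?mulmx0 //.
apply/matrixP => i j; rewrite ord1 !mxE; have /negPn/eqP {2}<- := h i.
by apply: eq_bigr => l _; rewrite !mxE mulrC.
Qed.

Lemma iter_chain_lazy_start x t (u := iter t (@chain_lazy n k) (start x)) : spans x ->
  [/\ forall z, 0 <= u z, \sum_z u z = #|{: config n k}|%:R &
      forall z, ~~ spans z -> u z = 0].
Proof.
rewrite /u => sx {u}; elim: t => [|t [p s h]] /=; split.
- by move=> z; rewrite /start mulr_ge0.
- rewrite /start (bigD1 x) //= eqxx mulr1 big1 ?addr0 // => z.
  by rewrite eq_sym => /negPf->; rewrite mulr0.
- move=> z sz; rewrite /start; case: eqP => [e|]; last by rewrite mulr0.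
  by case/negP: sz; rewrite -e.
- exact: chain_lazy_ge0.
- by rewrite sum_chain_lazy.
- move=> z sz; rewrite chain_lazy_split h // big1 ?mul0r ?addr0 // => b _.
  by apply: big1 => a _; apply: h; apply: contra sz; exact: spans_shift_site.
Qed.

(** * Weights of functionals as birth-death chains, and the Lyapunov bound *)

Definition weight p z : nat := #|[pred a | (dot p (z a) != 0)%R]|.

Lemma weight_sum p z : weight p z = (\sum_a (dot p (z a) != 0)%R)%N.
Proof. by rewrite /weight -sum1_card big_mkcond; apply: eq_bigr => a _; rewrite inE; case: ifP. Qed.

Lemma weight_shift p z a b : weight p (shift z b (z a)) =
  if dot p (z a) == 0 then weight p z
  else if dot p (z b) == 0 then (weight p z).+1 else (weight p z).-1.
Proof.
rewrite !weight_sum (bigD1 b) //= [in RHS](bigD1 b) //=.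
rewrite [X in (_ + X)%N](eq_bigr (fun i => nat_of_bool (dot p (z i) != 0)%R)); last first.
  by move=> i ib; rewrite shift_id_ne.
rewrite ffunE eqxx dotDr.
have [->|/F2_eq1->] := eqVneq (dot p (z a)) 0; first by rewrite addr0.
have [->|/F2_eq1->] := eqVneq (dot p (z b)) 0; first by rewrite add0r.
by [].
Qed.

(** The weight rises for the [w * (n - w)] ordered pairs with only [a] in the support of [p], and
    falls for the [w * (w - 1)] pairs with both indices in it. *)
Lemma chain_lazy_weight p (H : nat -> R) z (w := weight p z) :
  chain_lazy (fun y => H (weight p y)) z = H w +
  (w%:R * (n%:R - w%:R) * (H w.+1 - H w) + w%:R * (w%:R - 1) * (H w.-1 - H w))
  / (2 * (n * n.-1)%:R).
Proof.
pose c a : R := (dot p (z a) != 0)%:R.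
have sc : \sum_a c a = w%:R by rewrite /w weight_sum natr_sum.
have eqs : \sum_b \sum_(a | a != b) H (weight p (shift z b (z a))) =
   (n * n.-1)%:R * H w + (w%:R * (n%:R - w%:R) * (H w.+1 - H w)
     + w%:R * (w%:R - 1) * (H w.-1 - H w)).
  transitivity (\sum_(b < n) (n.-1%:R * H w + w%:R * (H w.+1 - H w)
      + c b * ((w%:R - 1) * (H w.-1 - H w) - w%:R * (H w.+1 - H w)))).
    apply: eq_bigr => b _.
    transitivity (\sum_(a | a != b) (H w +
      c a * ((1 - c b) * (H w.+1 - H w) + c b * (H w.-1 - H w)))).
      apply: eq_bigr => a _; rewrite weight_shift /c -/w.
      by case: (dot p (z a) == 0); case: (dot p (z b) == 0) => /=; lra.
    rewrite big_split /= sumr_const card_others -[_ *+ _]mulr_natl -mulr_suml.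
    have -> : \sum_(a | a != b) c a = w%:R - c b by rewrite -sc [X in _ = X - _](bigD1 b) //=; lra.
    by rewrite /c; case: (dot p (z b) == 0) => /=; lra.
  by rewrite big_split /= sum_sites_const -mulr_suml sc natrM; lra.
rewrite chain_lazy_split eqs natrM; field; rewrite !lt0r_neq0 //.
Qed.

(* The factor [1/w] makes the drift negative already at [w = 1]; [r ^ w] makes the function
   exponentially small at weights of order [n]. At [w = 0] the value is [0]. *)
Definition lyapunov (r : R) (w : nat) : R := r ^+ w / w%:R.

Lemma lyapunov_ge0 (r : R) (w : nat) : 0 <= r -> 0 <= lyapunov r w.
Proof. by move=> r0; rewrite divr_ge0 // exprn_ge0. Qed.

Lemma lyapunov_le (r : R) (w : nat) : 0 <= r -> lyapunov r w <= r ^+ w.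
Proof.
move=> r0; rewrite /lyapunov; case: w => [|w]; first by rewrite invr0 mulr0.
by rewrite ler_pdivrMr ?ltr0n // ler_peMr ?exprn_ge0 // ler1n.
Qed.

Lemma lyapunov_drift (r : R) (w : nat) : 2^-1 <= r <= 1 -> (0 < w)%N -> (8 * w.+1 <= n)%N ->
  w%:R * (n%:R - w%:R) * (lyapunov r w.+1 - lyapunov r w)
   + w%:R * (w%:R - 1) * (lyapunov r w.-1 - lyapunov r w)
  <= - (n.-1%:R / 4) * lyapunov r w.
Proof.
move=> /andP[r2 r1]; case: w => // w _ wn.
have wn' : 8 * (w%:R + 2) <= n%:R :> R by rewrite -natrD -natrM ler_nat addn2.
have en : n.-1%:R = n%:R - 1 :> R by rewrite -subn1 natrB // ltnW.
have w0 : 0 <= w%:R :> R by [].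
rewrite en /lyapunov -[w.+2%:R]natr1 -[w.+1%:R]natr1 !exprS.
set N : R := n%:R in wn' *; set W : R := w%:R in wn' w0 *.
set t := r ^+ w; have t0 : 0 < t by rewrite exprn_gt0 //; lra.
(* At weight one, [W = 0] and the quotient is 0 by convention, so equality weakens to an
   inequality. *)
have h1 : (W + 1) * (W + 1 - 1) * (t / w%:R) <= (W + 1) * t.
  rewrite addrK -mulrA ler_wpM2l //; first by lra.
  rewrite -/W; have [->|Wn0] := eqVneq W 0; first by rewrite mul0r ltW.
  by rewrite mulrC divfK.
set X := (W + 1) * (W + 1 - 1) * _ in h1.
have W1 : 0 < W + 1 by lra.
have W2 : 0 < W + 1 + 1 by lra.
rewrite [X in _ + X <= _]mulrBr -/X.
apply: (@le_trans _ _ (t * (- (r * ((N - W - 1) * (1 + (W + 1) * (1 - r)) / (W + 2)))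
    + (W + 1) * (1 - r) + r))).
  rewrite -subr_ge0; set Y := (W + 1) * (W + 1 - 1) * (r * t / _).
  have eY : Y = W * (r * t) by rewrite /Y addrK; field; rewrite lt0r_neq0.
  set Z := (W + 1) * (N - (W + 1)) * _.
  have eZ : Z = - (t * (r * ((N - W - 1) * (1 + (W + 1) * (1 - r)) / (W + 2)))).
    by rewrite /Z; field; rewrite !lt0r_neq0 //; lra.
  rewrite eY eZ /= -/W in h1 *; lra.
have -> : - ((N - 1) / 4) * (r * t / (W + 1)) = t * (- (r * ((N - 1) / (4 * (W + 1))))).
  by field; rewrite lt0r_neq0.
rewrite ler_wpM2l ?(ltW t0) //.
set q := 1 + (W + 1) * (1 - r); have q1 : 1 <= q by rewrite /q lerDl mulr_ge0 //; lra.
(* [A] measures the gain from upward moves and [B] is the target rate. The margin 2 in [2 + B <= A]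
   pays for the downward moves, as [h2] shows using [r >= 1/2]. *)
set A := (N - W - 1) / (W + 2); set B := (N - 1) / (4 * (W + 1)).
have -> : (N - W - 1) * q / (W + 2) = A * q by rewrite /A; lra.
have AB : 2 + B <= A.
  rewrite -subr_ge0.
  have -> : A - (2 + B) = (4 * (W + 1) * (N - W - 1) - 8 * (W + 1) * (W + 2)
      - (N - 1) * (W + 2)) / (4 * (W + 1) * (W + 2)).
    by rewrite /A /B; field; rewrite !lt0r_neq0 //; lra.
  apply: divr_ge0; last by rewrite !mulr_ge0 //; lra.
  have := mulr_ge0 (ltW W1) (_ : 0 <= N - 8 * (W + 2)); nra.
have B0 : 0 <= B by apply: divr_ge0; lra.
have h2 : (W + 1) * (1 - r) + r <= 2 * (r * q).
  have h3 : 0 <= ((W + 1) * (1 - r)) * (2 * r - 1) by rewrite !mulr_ge0 //; lra.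
  rewrite /q; lra.
clearbody q A B.
have h4 : 0 <= (A - 2 - B) * (r * q) by rewrite !mulr_ge0 //; lra.
have h5 : 0 <= B * (r * (q - 1)) by rewrite !mulr_ge0 //; lra.
lra.
Qed.

(** Below [B] the drift estimate applies. From weight [B] on, one step leads to weight at least
    [B.-1], where the function is at most [r ^+ B.-1]. *)
Lemma chain_lazy_lyapunov (r : R) (B : nat) p z : 2^-1 <= r <= 1 -> (8 * B <= n)%N ->
  chain_lazy (fun y => lyapunov r (weight p y)) z
  <= (1 - (8 * n%:R)^-1) * lyapunov r (weight p z) + r ^+ B.-1.
Proof.
move=> r21 Bn; have /andP[r2 r1] := r21; have r0 : 0 <= r by lra.
have B0 : 0 <= r ^+ B.-1 by rewrite exprn_ge0.
have d1 : 0 <= 1 - (8 * n%:R)^-1 :> R.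
  rewrite subr_ge0 invf_le1; have : 1 <= n%:R :> R by rewrite ler1n ltnW.
    by lra.
  by lra.
have [Bw|wB] := leqP B (weight p z).
  apply: (@le_trans _ _ (r ^+ B.-1)); last by rewrite lerDr mulr_ge0 // lyapunov_ge0.
  have mono i : (B.-1 <= i)%N -> lyapunov r i <= r ^+ B.-1.
    by move=> h; apply: le_trans (lyapunov_le _ r0) _; apply: ler_wiXn2l.
  apply: chain_lazy_le => [|a b _]; apply: mono; first by apply: leq_trans Bw; exact: leq_pred.
  rewrite weight_shift; case: ifP => _; last case: ifP => _; lia.
rewrite chain_lazy_weight; set w := weight p z in wB *.
have [->|w0] := posnP w.
  by rewrite /lyapunov !mulr0n invr0 !mulr0 !mul0r !addr0 !mul0r !add0r.
apply: ler_wpDr => //; have wn : (8 * w.+1 <= n)%N by apply: leq_trans Bn; rewrite leq_mul2l.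
have := lyapunov_drift r21 w0 wn; set X := (X in X <= _); move=> hX.
rewrite mulrBl mul1r lerD2l ler_pdivrMr; last first.
  by rewrite mulr_gt0 // ltr0n muln_gt0 -subn1 subn_gt0 n_gt1 ltnW.
apply: le_trans hX _; rewrite natrM le_eqVlt; apply/orP; left; apply/eqP.
by field; rewrite lt0r_neq0.
Qed.

(** Symmetry moves each step from the density to the Lyapunov function. The additive errors form a
    geometric series of ratio [1 - 1 / (8n)], whence the factor [8n]. *)
Lemma iter_chain_lazy_lyapunov (r : R) (B : nat) p x t : 2^-1 <= r <= 1 ->
  (8 * B <= n)%N -> spans x ->
  \sum_z iter t (@chain_lazy n k) (start x) z * lyapunov r (weight p z)
  <= ((1 - (8 * n%:R)^-1) ^+ t + 8 * n%:R * r ^+ B.-1) * #|{: config n k}|%:R.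
Proof.
move=> r21 Bn sx; have /andP[r2 r1] := r21; have r0 : 0 <= r by lra.
set C : R := #|_|%:R; have C0 : 0 < C := card_config_gt0.
set d : R := (8 * n%:R)^-1; have B0 : 0 <= r ^+ B.-1 by rewrite exprn_ge0.
have d1 : 0 <= 1 - d :> R.
  rewrite subr_ge0 invf_le1; have : 1 <= n%:R :> R by rewrite ler1n ltnW.
    by lra.
  by lra.
have dn : d * (8 * n%:R) = 1 by rewrite mulVf // lt0r_neq0 // mulr_gt0.
elim: t => [|t IH].
  rewrite expr0 /= (bigD1 x) //= big1 => [|z]; last first.
    by rewrite /start eq_sym => /negPf->; rewrite mulr0 mul0r.
  rewrite addr0 /start eqxx mulr1 mulrC -/C ler_wpM2r ?(ltW C0) //.
  apply: ler_wpDr; first by rewrite !mulr_ge0.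
  by apply: le_trans (lyapunov_le _ r0) _; rewrite exprn_ile1.
have [u0 su _] := iter_chain_lazy_start t sx.
rewrite iterS chain_lazy_sym; set u := iter t _ _ in u0 su IH *.
apply: (@le_trans _ _ (\sum_z u z * ((1 - d) * lyapunov r (weight p z) + r ^+ B.-1))).
  by apply: ler_sum => z _; rewrite ler_wpM2l // chain_lazy_lyapunov.
under eq_bigr do rewrite mulrDr mulrCA.
rewrite big_split /= -mulr_sumr -mulr_suml su -/C.
have := ler_wpM2l d1 IH; rewrite exprS.
have : d * (8 * n%:R) * (r ^+ B.-1 * C) = r ^+ B.-1 * C by rewrite dn mul1r.
lra.
Qed.

(** Markov's inequality and a union bound over the [2 ^ k] functionals. Spanning forces the weight
    of a nonzero [p] to be at least 1, so a weight at most [M] makes the Lyapunov function at least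
    [r ^+ M / M]. *)
Lemma iter_chain_lazy_bad (r : R) (B M : nat) x t : 2^-1 <= r <= 1 ->
  (8 * B <= n)%N -> (0 < M)%N -> spans x ->
  \sum_(z | bad M z) iter t (@chain_lazy n k) (start x) z
  <= (expn 2 k)%:R * (M%:R / r ^+ M *
     ((1 - (8 * n%:R)^-1) ^+ t + 8 * n%:R * r ^+ B.-1)) * #|{: config n k}|%:R.
Proof.
move=> r21 Bn M0 sx; have /andP[r2 r1] := r21; have r0 : 0 < r by lra.
have [u0 su hu] := iter_chain_lazy_start t sx; set u := iter t _ _ in u0 su hu *.
have M0' : 0 < M%:R :> R by rewrite ltr0n.
have rM : 0 < r ^+ M by rewrite exprn_gt0.
set K := M%:R / r ^+ M; have K0 : 0 < K by rewrite divr_gt0.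
apply: (@le_trans _ _ (\sum_(p : 'rV['F_2]_k) K * \sum_z u z * lyapunov r (weight p z))).
  under [X in _ <= X]eq_bigr => p _ do rewrite mulr_sumr.
  rewrite [X in _ <= X]exchange_big [X in X <= _]big_mkcond; apply: ler_sum => z _ /=.
  have t0 p : 0 <= K * (u z * lyapunov r (weight p z)).
    exact: mulr_ge0 (ltW K0) (mulr_ge0 (u0 z) (lyapunov_ge0 _ (ltW r0))).
  case: ifP => [/existsP[p /andP[p0 wp]]|_]; last exact: sumr_ge0.
  have [sz|/hu->] := boolP (spans z); last by apply: sumr_ge0 => q _; rewrite mul0r mulr0.
  rewrite (bigD1 p) //=; apply: ler_wpDr; first exact: sumr_ge0.
  rewrite mulrCA ler_peMr //.
  have w0 : (0 < weight p z)%N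
    by apply/card_gt0P; have [a ha] := spans_dot_neq0 sz p0; exists a; rewrite inE.
  have w0' : 0 < (weight p z)%:R :> R by rewrite ltr0n.
  rewrite /K /lyapunov mulrACA -invfM mulrC.
  rewrite mulrC ler_pdivlMr ?mulr_gt0 // mul1r [X in _ <= X]mulrC.
  by apply: ler_pM => //; [exact: ltW | apply: ler_wiXn2l => //; exact: ltW | rewrite ler_nat].
apply: (@le_trans _ _ (\sum_(p : 'rV['F_2]_k) K *
  (((1 - (8 * n%:R)^-1) ^+ t + 8 * n%:R * r ^+ B.-1) * #|{: config n k}|%:R))).
  by apply: ler_sum => p _; rewrite ler_wpM2l ?(ltW K0) // iter_chain_lazy_lyapunov.
set Y := K * _; rewrite sumr_const card_mx card_Fp // mul1n -[Y *+ _]mulr_natl.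
by rewrite /Y /K !mulrA lexx.
Qed.

End LazyChain.

(** * From densities on V^n to total variation on St, and L1 decay of the modified chain *)

(* The division in [tv] is that of [R_scope]. *)
Lemma tvE n k (mu nu : config n k -> R) :
  tv mu nu = (\sum_(y : config n k) `|mu y - nu y|) / 2.
Proof. by rewrite /tv RdivE IZRposE INRE. Qed.

(** The density vanishes off the spanning set, so the complement has size at most [D]. Renormalising
    the uniform law to [St n k] costs twice that size, and the L1 distance is at most
    [3 * D / C <= 1/2]. *)
Lemma tv_le_of_sum_abs n k t (x : config n k) : (1 < n)%N -> spans x ->
  \sum_z `|iter t (@chain_lazy n k) (start x) z - 1| <= #|{: config n k}|%:R / 6 ->
  tv (Qpow t x) (@piU n k) <= 1 / 4.
Proof.
move=> n_gt1 sx; have [u0 su hu] := iter_chain_lazy_start n_gt1 t sx.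
have Qe y := Qpow_iter_chain_lazy n_gt1 t x y.
set u := iter t _ _ in u0 su hu Qe *.
set C : R := #|_|%:R in su Qe *; have C0 : 0 < C := card_config_gt0 n k.
set D := \sum_z _ => hD.
have s0 : 0 < #|St n k|%:R :> R by rewrite ltr0n; apply/card_gt0P; exists x; rewrite inE.
set s : R := #|St n k|%:R in s0 *.
have eS : \sum_(z : config n k) (spans z)%:R = s.
  rewrite /s -sum1_card natr_sum [RHS]big_mkcond; apply: eq_bigr => z _.
  by rewrite inE; case: spans.
have eC : \sum_(z : config n k) (1 : R) = C by rewrite sumr_const.
have hout : C - s <= D.
  rewrite -eC -eS -sumrB; apply: ler_sum => z _.
  case: (boolP (spans z)) => sz; first by rewrite subrr.
  by rewrite subr0 hu // sub0r normrN normr1.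
have sC : 0 <= C - s.
  by rewrite -eC -eS -sumrB sumr_ge0 // => z _; case: spans; rewrite ?subrr ?subr0.
have isC : C^-1 <= s^-1 by rewrite lef_pV2 ?posrE //; lra.
have h : \sum_y `|Qpow t x y - piU y| <=
   \sum_y (`|u y - 1| / C + (C^-1 + (spans y)%:R * (s^-1 - C^-1 - C^-1))).
  apply: ler_sum => y _; rewrite Qe /piU inE -/s.
  have -> : u y / C - (spans y)%:R / s = (u y - 1) / C + (C^-1 - (spans y)%:R / s) by lra.
  apply: le_trans (ler_normD _ _) _; rewrite normrM normfV (gtr0_norm C0) lerD2l.
  have := ltW C0; rewrite -invr_ge0 => iC0.
  case: (spans y) => /=; last by rewrite !mul0r subr0 addr0 ger0_norm.
  by rewrite !mul1r distrC ger0_norm ?subr_ge0 //; lra.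
rewrite tvE.
have e2 : \sum_y (`|u y - 1| / C + (C^-1 + (spans y)%:R * (s^-1 - C^-1 - C^-1)))
   = (D + 2 * (C - s)) / C.
  rewrite !big_split /= -!mulr_suml eS sumr_const -[_ *+ _]mulr_natl -/C -/D.
  by field; rewrite !lt0r_neq0.
have : (D + 2 * (C - s)) / C <= 1 / 2 by rewrite ler_pdivrMr //; lra.
lra.
Qed.

(** Entropy contraction asks for strictly positive densities, while [start x] vanishes off [x].
    Averaging with the constant 1 repairs this and commutes with the chain. *)
Lemma chain_mod_affine n k M t (g : config n k -> R) z : (1 < n)%N ->
  iter t (@chain_mod n k M) (fun y => (g y + 1) / 2) z
  = (iter t (@chain_mod n k M) g z + 1) / 2.
Proof.
move=> n_gt1.
have n0 : n%:R != 0 :> R by rewrite pnatr_eq0 -lt0n ltnW.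
have n1 : n.-1%:R != 0 :> R by rewrite pnatr_eq0 -lt0n -subn1 subn_gt0.
elim: t z => //= t IH z; set G := iter t _ g in IH *.
have site b : site_mod M b (iter t (@chain_mod n k M) (fun y => (g y + 1) / 2)) z
    = site_mod M b G z / 2 + 1 / 2.
  rewrite /site_mod; case: ifP => _.
    rewrite /site_lazy.
    transitivity ((\sum_(a | a != b) ((G z + G (shift z b (z a))) / 2 / 2 + 1 / 2))
        / n.-1%:R).
      by congr (_ / _); apply: eq_bigr => a _; rewrite !IH; lra.
    by rewrite big_split /= sumr_const card_others -mulr_suml -[_ *+ _]mulr_natl; field.
  rewrite /avg_site; under eq_bigr do rewrite IH.
  rewrite -mulr_suml big_split /= sumr_const -[_ *+ #|_|]mulr_natl; field.
  by rewrite lt0r_neq0 // card_row2_gt0.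
rewrite /chain_mod; under eq_bigr do rewrite site.
by rewrite big_split /= sum_sites_const -mulr_suml; field.
Qed.

(** The positive density [f] is at most [C], so its entropy sum starts below [C * ln C]. After the
    contraction, [abs_sub1_le] with parameter [d] returns to L1, and undoing the averaging with 1
    doubles the bound. *)
Lemma sum_abs_iter_chain_mod n k M t (g : config n k -> R) (e d : R)
    (C : R := #|{: config n k}|%:R) : (1 < n)%N ->
  (forall z, 0 <= g z) -> \sum_z g z = C -> 0 <= e <= 1 ->
  e * (10 + 8 * ln #|{: 'rV['F_2]_k}|%:R) * n%:R <= M%:R -> 0 < d ->
  \sum_z `|iter t (@chain_mod n k M) g z - 1|
  <= ((1 - e / n%:R) ^+ t * ln C / d + 4 * d) * C.
Proof.
move=> n_gt1 g0 sg e01 eM d0; have C0 : 0 < C := card_config_gt0 n k.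
have C1 : 1 <= C by rewrite ler1n -(ltr0n R).
pose f z := (g z + 1) / 2; have f0 z : 0 < f z by have := g0 z; rewrite /f; lra.
have sf : \sum_z f z = C.
  by rewrite -mulr_suml big_split /= sg sumr_const -/C; lra.
have fC z : f z <= C.
  suff : g z <= C by rewrite /f; lra.
  by rewrite -sg (bigD1 z) //= lerDl sumr_ge0.
have [F0 sF hF] := iter_chain_mod_entropy n_gt1 t f0 sf e01 eM.
set F := iter t _ f in F0 sF hF.
have hf : \sum_z xlnx (f z) <= C * ln C.
  rewrite -[X in X * _]sf mulr_suml; apply: ler_sum => z _.
  by rewrite ler_wpM2l ?(ltW (f0 z)) // ler_ln.
have d1 : 0 <= 1 - e / n%:R.
  rewrite subr_ge0 ler_pdivrMr ?mul1r ?ltr0n 1?ltnW //.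
  by case/andP: e01 => _ /le_trans; apply; rewrite ler1n ltnW.
have hF2 : \sum_z xlnx (F z) <= (1 - e / n%:R) ^+ t * (C * ln C).
  by apply: le_trans hF _; rewrite ler_wpM2l ?exprn_ge0.
have h : \sum_z `|F z - 1| <= \sum_z ((xlnx (F z) - F z + 1) / (2 * d) + d * (F z + 1)).
  by apply: ler_sum => z _; exact: abs_sub1_le.
have e1 : \sum_z `|iter t (@chain_mod n k M) g z - 1| = 2 * \sum_z `|F z - 1|.
  rewrite mulr_sumr; apply: eq_bigr => z _; rewrite /F chain_mod_affine //.
  rewrite -[X in X * _](ger0_norm (_ : 0 <= 2 :> R)) // -normrM; congr `|_|; lra.
have e2 : \sum_z ((xlnx (F z) - F z + 1) / (2 * d) + d * (F z + 1))
  = (\sum_z xlnx (F z)) / (2 * d) + 2 * d * C.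
  rewrite big_split /= -mulr_suml -mulr_sumr !big_split /= sumrN sF sumr_const -/C.
  lra.
rewrite e1; apply: (@le_trans _ _ (2 * ((1 - e / n%:R) ^+ t * (C * ln C) / (2 * d) + 2 * d * C))).
  rewrite ler_wpM2l //; apply: le_trans h _; rewrite e2 lerD2r.
  by rewrite ler_wpM2r // invr_ge0 mulr_ge0 // ltW.
rewrite le_eqVlt; apply/orP; left; apply/eqP; field; exact: lt0r_neq0.
Qed.

(** * Choice of parameters and the final estimate *)

Lemma ln2_bounds : 2^-1 <= ln 2 <= 1.
Proof.
have p2 : 0 < 2 :> R by []; have pV2 : 0 < 2^-1 :> R by rewrite invr_gt0.
have := ln_le_sub1 p2; have := ln_le_sub1 pV2; rewrite lnV //; lra.
Qed.

Lemma ln_card_row2_le k : ln #|{: 'rV['F_2]_k}|%:R <= k%:R.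
Proof.
rewrite card_mx card_Fp // mul1n natrX lnX //.
by have /andP[_ h] := ln2_bounds; rewrite ler_piMr.
Qed.

Lemma ln_card_config_le n k : ln #|{: config n k}|%:R <= n%:R * k%:R.
Proof.
rewrite card_ffun card_ord card_mx card_Fp // mul1n -expnM natrX lnX //.
by have /andP[_ h] := ln2_bounds; rewrite -natrM mulnC ler_piMr.
Qed.

Lemma up_log2_le_ln n : (4 <= n)%N -> (up_log 2 n)%:R <= 4 * ln n%:R.
Proof.
move=> n4; have /andP[h1 h2] := @up_log_bounds 2 n isT (leq_trans (isT : 1 < 4)%N n4).
set L := up_log 2 n in h1 h2 *.
have L2 : (1 < L)%N by rewrite -(@ltn_exp2l 2) //; apply: leq_trans h2; exact: leq_trans n4.
have n0 : 0 < n%:R :> R by rewrite ltr0n; exact: leq_trans n4.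
have : ln (2 ^+ L.-1) <= ln n%:R.
  by rewrite ler_ln ?exprn_gt0 // -natrX ler_nat ltnW.
rewrite lnX // => h3; have /andP[h4 _] := ln2_bounds.
have : L%:R <= 2 * L.-1%:R :> R by rewrite -natrM ler_nat; lia.
have : L.-1%:R * 2^-1 <= L.-1%:R * ln 2 by rewrite ler_wpM2l.
lra.
Qed.

Lemma up_log2_small n : (expn 2 14 <= n)%N -> (expn 2 9 * up_log 2 n <= n)%N.
Proof.
move=> n14; have n1 : (1 < n)%N by apply: leq_trans n14; rewrite (@ltn_exp2l 2 0).
have /andP[h1 h2] := @up_log_bounds 2 n isT n1; set L := up_log 2 n in h1 h2 *.
have L14 : (14 <= L)%N by rewrite -(@leq_exp2l 2) //; exact: leq_trans h2.
apply: leq_trans (ltnW h1); have -> : L.-1 = (9 + (L - 14 + 4))%N by lia.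
rewrite expnD leq_mul2l; apply/orP; right.
have {1}-> : L = (L - 14 + 14)%N by lia.
(* The claim is now [L <= 2 ^ (L - 10)]: at 14 it reads [14 <= 16], and doubling preserves it. *)
elim: (L - 14)%N => // j; rewrite !addSn expnS; lia.
Qed.

(** With [M = N * q] and [B = 4 * M], the price [M / r ^+ M] is at most [n * 2 ^ q], while time
    decay and error term are of order [2 ^ (- 2q)] up to a factor [n]. The spare [2 ^ (- q)] beats
    the union bound and leaves [n ^ (-6)]. *)
Lemma burn_in_bad n k (x : config n k) (q N s : nat) : (1 < n)%N -> spans x ->
  (0 < N)%N -> (0 < q)%N -> (32 * (N * q) <= n)%N -> (expn 2 k * expn n 8 <= expn 2 q)%N ->
  \sum_(z | bad (N * q) z) iter (s + 16 * n * q) (@chain_lazy n k) (start x) z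
  <= 17 / n%:R ^+ 6 * #|{: config n k}|%:R.
Proof.
move=> n1 sx N0 q0 hNq hX; set C : R := #|_|%:R; have C0 : 0 < C := card_config_gt0 n k.
have n0' : 0 < n%:R :> R by rewrite ltr0n ltnW.
have N0' : 1 <= N%:R :> R by rewrite ler1n.
(* This [r] loses a bounded factor over [N] steps of weight: [r ^+ N >= 1/2] and
   [r ^+ (2 * N) <= 1/2]. *)
pose r : R := 1 - (2 * N%:R)^-1.
have rN := half_le_one_sub_inv_expn N0; rewrite -/r in rN.
have i2N0 : 0 < (2 * N%:R)^-1 :> R by rewrite invr_gt0; lra.
have i2N1 : (2 * N%:R)^-1 <= 2^-1 :> R by rewrite lef_pV2 ?posrE //; lra.
have r21 : 2^-1 <= r <= 1 by apply/andP; rewrite /r; split; lra.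
have r0 : 0 < r by case/andP: r21; lra.
have M0 : (0 < N * q)%N by rewrite muln_gt0 N0.
have hB : (8 * (4 * (N * q)) <= n)%N by rewrite mulnA.
apply: le_trans (iter_chain_lazy_bad n1 _ r21 hB M0 sx) _.
rewrite ler_wpM2r ?(ltW C0) //.
set X : R := 2 ^+ q; have X0 : 0 < X by rewrite exprn_gt0.
have hXinv : 2^-1 ^+ (2 * q) = (X ^+ 2)^-1 by rewrite mulnC exprM !exprVn.
have hM : (N * q)%:R / r ^+ (N * q) <= n%:R * X.
  rewrite ler_pdivrMr ?exprn_gt0 //.
  have h1 : X^-1 <= r ^+ (N * q).
    by rewrite exprM -exprVn lerXn2r ?nnegrE ?exprn_ge0 ?invr_ge0 ?(ltW r0).
  have h2 : 1 <= X * r ^+ (N * q).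
    by have := ler_wpM2l (ltW X0) h1; rewrite divff // lt0r_neq0.
  apply: (@le_trans _ _ (n%:R * 1)); last by rewrite -mulrA ler_wpM2l // ltW.
  rewrite mulr1 ler_nat; apply: leq_trans hNq; exact: leq_pmull.
have hd0 : 0 <= 1 - (8 * n%:R)^-1 :> R.
  rewrite subr_ge0 invf_le1 ?mulr_gt0 //.
  by (have : 1 <= n%:R :> R by rewrite ler1n ltnW); lra.
have hd1 : 1 - (8 * n%:R)^-1 <= 1 :> R by rewrite lerBlDr lerDl invr_ge0 mulr_ge0 // ltW.
have h1 : (1 - (8 * n%:R)^-1) ^+ (s + 16 * n * q) <= (X ^+ 2)^-1.
  rewrite exprD -[X in _ <= X]mul1r; apply: ler_pM; rewrite ?exprn_ge0 //.
    exact: exprn_ile1.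
  rewrite (_ : (16 * n * q = 8 * n * (2 * q))%N); last by rewrite mulnACA mulnA.
  rewrite exprM -hXinv lerXn2r ?nnegrE ?exprn_ge0 ?invr_ge0 // -natrM.
  by apply: one_sub_inv_expn_le; rewrite muln_gt0 (ltnW n1).
(* The missing factor [r >= 1/2] in the exponent accounts for the 2. *)
have h2 : r ^+ (4 * (N * q)).-1 <= 2 * (X ^+ 2)^-1.
  have e4 : r ^+ (4 * (N * q)) = r * r ^+ (4 * (N * q)).-1.
    by rewrite -exprS prednK // muln_gt0.
  have h4 : r ^+ (4 * (N * q)) <= (X ^+ 2)^-1.
    rewrite (_ : (4 * (N * q) = 2 * N * (2 * q))%N); last by rewrite mulnACA.
    rewrite exprM -hXinv lerXn2r ?nnegrE ?exprn_ge0 ?invr_ge0 ?(ltW r0) // /r -natrM.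
    by apply: one_sub_inv_expn_le; rewrite muln_gt0.
  have h5 : 0 <= r ^+ (4 * (N * q)).-1 by rewrite exprn_ge0 // ltW.
  have h6 : 0 <= (r - 2^-1) * r ^+ (4 * (N * q)).-1.
    by rewrite mulr_ge0 //; case/andP: r21; lra.
  lra.
set D := (1 - _) ^+ _ in h1 *; set r' := r ^+ _ in h2 *.
have D0 : 0 <= D by rewrite exprn_ge0.
have r'0 : 0 <= r' by rewrite exprn_ge0 // ltW.
have iX0 : 0 < (X ^+ 2)^-1 by rewrite invr_gt0 exprn_gt0.
have n1' : 1 <= n%:R :> R by rewrite ler1n ltnW.
have h3 : D + 8 * n%:R * r' <= 17 * n%:R * (X ^+ 2)^-1.
  have := ler_wpM2l (mulr_ge0 (ler0n R 8) (ltW n0')) h2.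
  have := mulr_ge0 (ltW iX0) (_ : 0 <= n%:R - 1); rewrite subr_ge0 => /(_ n1').
  lra.
have K0 : 0 <= (N * q)%:R / r ^+ (N * q) by rewrite divr_ge0 // exprn_ge0 // ltW.
apply: (@le_trans _ _ ((expn 2 k)%:R * (n%:R * X * (17 * n%:R * (X ^+ 2)^-1)))).
  rewrite ler_wpM2l // ler_pM // addr_ge0 // !mulr_ge0 //; exact: ltW.
have hX' : (expn 2 k)%:R * n%:R ^+ 8 <= X by rewrite /X -!natrX -natrM ler_nat.
have -> : (expn 2 k)%:R * (n%:R * X * (17 * n%:R * (X ^+ 2)^-1)) =
    17 / n%:R ^+ 6 * (((expn 2 k)%:R * n%:R ^+ 8) / X).
  by field; rewrite !lt0r_neq0.
rewrite ler_piMr // ?divr_ge0 ?exprn_ge0 ?(ltW n0') //.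
by rewrite ler_pdivrMr // mul1r.
Qed.

(** After a burn-in of [16 * n * q] steps, the two chains are run for [T] steps from the same
    density. Their distance is at most [T] times an error of order [n ^ (-6)], and [T] is of order
    at most [n ^ 3]. *)
Lemma sum_abs_start_le n k (x : config n k) (q N L : nat)
    (T := (1152 * n * k * (4 * L))%N) :
  (1 < n)%N -> spans x -> (0 < k <= n)%N -> (0 < N)%N -> (0 < q)%N ->
  (32 * (N * q) <= n)%N -> (n <= 64 * (N * q))%N ->
  (expn 2 k * expn n 8 <= expn 2 q)%N -> (n <= expn 2 L)%N -> (L <= n)%N ->
  (1000 <= n)%N ->
  \sum_z `|iter (T + 16 * n * q) (@chain_lazy n k) (start x) z - 1|
  <= #|{: config n k}|%:R / 6.
Proof.
move=> n1 sx /andP[k0 kn] N0 q0 hNq hNq2 hX nL Ln n1000.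
set C : R := #|_|%:R; have C0 : 0 < C := card_config_gt0 n k.
have n0' : 0 < n%:R :> R by rewrite ltr0n ltnW.
have k0' : 0 < k%:R :> R by rewrite ltr0n.
have k1' : 1 <= k%:R :> R by rewrite ler1n.
have kn' : k%:R <= n%:R :> R by rewrite ler_nat.
have Ln' : L%:R <= n%:R :> R by rewrite ler_nat.
have n1000' : 1000 <= n%:R :> R by rewrite (ler_nat R 1000).
rewrite iterD; set g := iter (16 * n * q) _ _.
have [g0 sg _] := iter_chain_lazy_start n1 (16 * n * q) sx.
rewrite -/g in g0 sg.
(* Here [1152 = 18 * 64]: [10 + 8 * ln c <= 18 * k], and [N * q >= n / 64]. *)
pose e : R := (1152 * k%:R)^-1.
have e0 : 0 < e by rewrite invr_gt0 mulr_gt0.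
have e01 : 0 <= e <= 1 by rewrite (ltW e0) invf_le1 ?mulr_gt0 //; lra.
have eM : e * (10 + 8 * ln #|{: 'rV['F_2]_k}|%:R) * n%:R <= (N * q)%:R.
  have h1 : 10 + 8 * ln #|{: 'rV['F_2]_k}|%:R <= 18 * k%:R.
    by have := ln_card_row2_le k; lra.
  apply: (@le_trans _ _ (e * (18 * k%:R) * n%:R)).
    by rewrite ler_wpM2r ?(ltW n0') // ler_wpM2l // ltW.
  have -> : e * (18 * k%:R) * n%:R = n%:R / 64 by rewrite /e; field; exact: lt0r_neq0.
  by rewrite ler_pdivrMr // mulrC -natrM ler_nat.
(* With [d = 1/48] the term [4 * d] is [1/12]; comparison error and entropy term take [1/24] each,
   in total [1/6]. *)
have d0 : 0 < 48^-1 :> R by rewrite invr_gt0.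
have h1 := sum_abs_iter_chain_mod T n1 g0 sg e01 eM d0.
have h2 := iter_chain_lazy_mod (N * q) n1 T g0.
rewrite -/C in h1.
have h3 : \sum_(s < T) 2 * \sum_(z | bad (N * q) z) iter s (@chain_lazy n k) g z
    <= T%:R * (2 * (17 / n%:R ^+ 6 * C)).
  rewrite -sum_sites_const; apply: ler_sum => s _.
  by rewrite ler_wpM2l // /g -iterD; exact: burn_in_bad.
pose b : R := 1152 * 4; have b0 : 0 <= b by rewrite mulr_ge0.
have bn : b <= n%:R * n%:R.
  have b1 : 1152 <= 2 * n%:R :> R.
    by rewrite -natrM (ler_nat R 1152); apply: leq_trans (leq_mul (leqnn 2) n1000).
  have n8 : 8 <= n%:R :> R by rewrite (ler_nat R 8); apply: leq_trans n1000.
  apply: (@le_trans _ _ (2 * n%:R * 4)); first by rewrite /b ler_wpM2r.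
  by rewrite mulrAC ler_wpM2r ?(ltW n0') // -natrM.
have hT : T%:R <= b * n%:R ^+ 3.
  have -> : T%:R = b * (n%:R * (k%:R * L%:R)).
    by rewrite /T /b !natrM; move: (1152 : R) => c; lra.
  by rewrite ler_wpM2l // !exprS expr0 mulr1 ler_wpM2l ?(ltW n0') // ler_pM.
have h4 : T%:R * (2 * (17 / n%:R ^+ 6 * C)) <= C / 24.
  have n30 : 0 < n%:R ^+ 3 :> R by rewrite exprn_gt0.
  have h5 : 0 <= 2 * (17 / n%:R ^+ 6 * C) by rewrite !mulr_ge0 // ?invr_ge0 ?exprn_ge0 // ltW.
  apply: le_trans (ler_wpM2r h5 hT) _; clearbody b.
  have -> : b * n%:R ^+ 3 * (2 * (17 / n%:R ^+ 6 * C)) = C * ((34 * b) / n%:R ^+ 3).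
    by field; exact: lt0r_neq0.
  rewrite ler_wpM2l ?(ltW C0) // ler_pdivrMr //.
  have h6 : 816 * b <= n%:R * (n%:R * n%:R).
    by rewrite ler_pM //; apply: le_trans n1000'; rewrite ler_nat.
  by rewrite !exprS expr0 mulr1; lra.
(* [T] is [4 * L] periods of length [n / e], each halving the entropy; this gives [n ^ (-4)] against
   [ln C <= n * k <= n ^ 2]. *)
have h5 : (1 - e / n%:R) ^+ T * ln C / 48^-1 <= 1 / 24.
  have lnC := ln_card_config_le n k; rewrite -/C in lnC.
  have lnC0 : 0 <= ln C by rewrite -ln_one ler_ln // ler1n -(ltr0n R).
  have ee : 1 - e / n%:R = 1 - (1152 * n * k)%:R^-1.
    by rewrite /e !natrM; field; rewrite !lt0r_neq0.
  have ee0 : 0 <= 1 - (1152 * n * k)%:R^-1 :> R.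
    rewrite subr_ge0 invf_le1 ?ler1n ?ltr0n !muln_gt0 k0 andbT /=; exact: ltnW.
  have hpow : (1 - e / n%:R) ^+ T <= (n%:R ^+ 4)^-1.
    rewrite ee /T exprM; apply: (@le_trans _ _ (2^-1 ^+ (4 * L))).
      rewrite lerXn2r ?nnegrE ?exprn_ge0 ?invr_ge0 //; apply: one_sub_inv_expn_le.
      by rewrite !muln_gt0 k0 (ltnW n1).
    rewrite mulnC exprM -exprVn lerXn2r ?nnegrE ?exprn_ge0 ?invr_ge0 ?(ltW n0') //.
    by rewrite exprVn lef_pV2 ?posrE ?exprn_gt0 // -natrX ler_nat.
  rewrite invrK; apply: (@le_trans _ _ ((n%:R ^+ 4)^-1 * (n%:R * n%:R) * 48)).
    rewrite ler_wpM2r // ler_pM // ?exprn_ge0 ?ee //.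
    by apply: le_trans lnC _; rewrite ler_wpM2l // ltW.
  have -> : (n%:R ^+ 4)^-1 * (n%:R * n%:R) * 48 = 48 / (n%:R * n%:R) :> R.
    by field; exact: lt0r_neq0.
  have n20 : 0 < n%:R * n%:R :> R by rewrite mulr_gt0.
  by rewrite ler_pdivrMr //; nra.
apply: (@le_trans _ _ (\sum_z (`|iter T (@chain_lazy n k) g z - iter T (@chain_mod n k (N * q)) g z|
    + `|iter T (@chain_mod n k (N * q)) g z - 1|))).
  by apply: ler_sum => z _; apply: le_trans (ler_normD _ _); rewrite addrA subrK.
rewrite big_split /=.
apply: le_trans (lerD (le_trans h2 (le_trans h3 h4))
  (le_trans h1 (ler_wpM2r (ltW C0) (lerD h5 (lexx _))))) _.
lra.
Qed.

Theorem theorem3p5 :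
  exists (eps0 Clin : R), 0 < eps0 /\
  exists n0 : nat, forall n : nat, leq n0 n ->
  forall k : nat, leq 1 k -> k%:R <= eps0 * n%:R ->
  exists t : nat,
    t%:R <= Clin * n%:R * k%:R * Rpower.ln n%:R /\ mixes_by n k t.
Proof.
(* The total time is [4608 * n * k * L + 128 * n * (k + L)], at most [4864 * n * k * L]; the factor
   4 comes from [L <= 4 * ln n]. The value [2 ^- 9] makes [32 * q = 256 * (k + L)] at most [n]. *)
exists (2 ^+ 9)^-1, (4 * 4864); split; first by rewrite invr_gt0 exprn_gt0.
exists (expn 2 14) => n n14 k k1 hk.
have n0 : (0 < n)%N by apply: leq_trans n14; rewrite expn_gt0.
have n1 : (1 < n)%N by apply: leq_trans n14; rewrite (@ltn_exp2l 2 0).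
have n1000 : (1000 <= n)%N by apply: leq_trans n14; rewrite (expnD 2 10 4); lia.
have hk2 : (expn 2 9 * k <= n)%N.
  move: hk; rewrite mulrC ler_pdivlMr ?exprn_gt0 // -natrX -natrM ler_nat.
  by rewrite mulnC.
have hL := up_log2_small n14; have lnL := up_log2_le_ln (leq_trans (isT : 4 <= 1000)%N n1000).
have /andP[_ nL] := @up_log_bounds 2 n isT n1.
have L0 : (0 < up_log 2 n)%N by rewrite lt0n; apply: contraTneq nL => ->; rewrite -ltnNge.
set L := up_log 2 n in hL lnL nL L0.
(* The factor 8 gives [2 ^ q >= 2 ^ k * n ^ 8]; [N] is the largest integer with [32 * N * q <= n],
   which puts [N * q] between [n / 64] and [n / 32]. *)
pose q := (8 * (k + L))%N; pose N := (n %/ (32 * q))%N.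
have q0 : (0 < q)%N by rewrite muln_gt0 addn_gt0 k1.
have hq : (32 * q <= n)%N by move: hk2 hL; rewrite /q (_ : expn 2 9 = 512) //; lia.
have N0 : (0 < N)%N by rewrite divn_gt0 // muln_gt0.
have hNq : (32 * (N * q) <= n)%N by rewrite mulnCA; exact: leq_divM.
have hNq2 : (n <= 64 * (N * q))%N.
  have : (n < N.+1 * (32 * q))%N by rewrite ltn_ceil // muln_gt0.
  nia.
have kn : (k <= n)%N by apply: leq_trans hk2; rewrite leq_pmull // expn_gt0.
have Ln : (L <= n)%N by apply: leq_trans hL; rewrite leq_pmull // expn_gt0.
have hX : (expn 2 k * expn n 8 <= expn 2 q)%N.
  rewrite /q mulnDr expnD leq_mul ?leq_exp2l ?leq_pmull //.
  by rewrite mulnC expnM leq_exp2r.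
exists (1152 * n * k * (4 * L) + 16 * n * q)%N; split; last first.
  move=> x; rewrite inE => sx; apply: tv_le_of_sum_abs => //.
  by apply: (sum_abs_start_le (N := N)) => //; rewrite k1.
apply: (@le_trans _ _ ((4864 * (n * k * L))%N%:R)).
  rewrite ler_nat /q; have : (k + L <= 2 * (k * L))%N by nia.
  move=> h; have : (n * (k + L) <= n * (2 * (k * L)))%N by rewrite leq_mul2l h orbT.
  lia.
rewrite !natrM; have nk0 : 0 <= 4864 * (n%:R * k%:R) :> R by rewrite !mulr_ge0.
have := ler_wpM2l nk0 lnL; lra.
Qed.
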